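(* Let $D\subset\mathbb{R}^d$ be a domain, and fix a closed ball $\bar B_o(r)=\{x\in\mathbb{R}^d: |x-o|\le r\}\subset D$ with $o\in D$, $r>0$. Let $H\subset \operatorname{sbh}(D)$ be a convex cone (closed under sums and under multiplication by nonnegative reals) that contains the constant functions $0$ and $-1$, and suppose that for every sequence $(h_k)_{k\in\mathbb{N}}$ of functions $h_k\in H$ which is locally uniformly bounded above on $D$, the upper semicontinuous regularization of the pointwise upper limit $\limsup_{k\to\infty}h_k$ belongs to $H$. Let $g\in C(D)$ and $h_1,h_2\in H$ with $h_1,h_2\not\equiv-\infty$, put $s:=g+h_1-h_2$, and let $f$ be any function defined $\mathfrak m_d$-almost everywhere on $D$ with $f=s$ $\mathfrak m_d$-a.e. Then $$ \sup\Bigl\{\int_{\bar B_o(r)} h\,d\mathfrak m_d \;\Bigm|\; h\in H,\ h\not\equiv-\infty,\ h\le f\ \mathfrak m_d\text{-a.e. on } D\Bigr\} =\inf_{\mu\in J_H}\int_D s\,d\mu , $$ where $$ J_H:=\Bigl\{\mu\in \mathrm{Meas}_0^+(D)\;\Bigm|\; \int_{\bar B_o(r)} h\,d\mathfrak m_d\le \int_D h\,d\mu\ \text{ for all } h\in H\Bigr\}, $$ and $\int_D s\,d\mu:=\int_D g\,d\mu+\int_D h_1\,d\mu-\int_D h_2\,d\mu$ (all three integrals are finite for $\mu\in J_H$). Both sides take values in $[-\infty,+\infty]$, with the conventions $\sup\emptyset=-\infty$, $\inf\emptyset=+\infty$. In particular, there exists $h\in H$, $h\not\equiv-\infty$, with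 $h\le f$ $\mathfrak m_d$-a.e. on $D$ if and only if $\inf_{\mu\in J_H}\int_D s\,d\mu\neq-\infty$.
   Context: $\mathfrak m_d$ denotes Lebesgue measure on $\mathbb{R}^d$; ''a.e.'' always refers to $\mathfrak m_d$. $C(D)$ is the space of real-valued continuous functions on $D$. $\operatorname{sbh}(D)$ is the convex cone of all subharmonic functions on $D$, including the function identically equal to $-\infty$. A constant $c$ is regarded as the function identically equal to $c$. $\mathrm{Meas}_0^+(D)$ is the class of all positive finite Borel measures on $D$ with compact support contained in $D$. *)

(* Defs.v *)
From HB Require Import structures.
From mathcomp Require Import all_boot all_order all_algebra.
From mathcomp Require Import all_classical all_reals all_analysis.
Import Order.TTheory GRing.Theory Num.Theory.
Import numFieldNormedType.Exports.

Set Implicit Arguments.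
Unset Strict Implicit.
Unset Printing Implicit Defensive.

Local Open Scope classical_set_scope.
Local Open Scope ring_scope.

(** R^d is modelled as the row vectors ['rV[R]_d] (with their product
    topology, which is the Euclidean topology).  The Euclidean norm and balls
    are defined explicitly (the library norm on ['rV] is the max norm). *)

Definition BorelRd (R : realType) (d : nat) :=
  g_sigma_algebraType (@open 'rV[R]_d).

Definition enorm {R : realType} {d : nat} (x : 'rV[R]_d) : R :=
  Num.sqrt (\sum_(i < d) x ord0 i ^+ 2).

Definition cball {R : realType} {d : nat} (o : 'rV[R]_d) (r : R) :
  set 'rV[R]_d := [set x | enorm (x - o) <= r].

Definition oball {R : realType} {d : nat} (o : 'rV[R]_d) (r : R) :
  set 'rV[R]_d := [set x | enorm (x - o) < r].

(** [lam] is Lebesgue measure m_d on the Borel sets of R^d: it gives every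
    closed box its volume (this determines it uniquely on the Borel sets). *)
Definition is_lebesgue_measure {R : realType} {d : nat}
  (lam : {measure set (BorelRd R d) -> \bar R}) : Prop :=
  forall a b : 'rV[R]_d, (forall i, a ord0 i <= b ord0 i) ->
    lam [set x : BorelRd R d | forall i, a ord0 i <= x ord0 i <= b ord0 i]
    = (\prod_(i < d) (b ord0 i - a ord0 i))%:E.

Definition is_domain {R : realType} {d : nat} (D : set 'rV[R]_d) : Prop :=
  open D /\ connected D /\ D !=set0.

Definition usc_on {R : realType} {d : nat} (D : set 'rV[R]_d)
  (u : 'rV[R]_d -> \bar R) : Prop :=
  forall x, D x -> forall a : R, (u x < a%:E)%E ->
    \forall y \near x, (u y < a%:E)%E.

(** subharmonic on D (the function identically -oo is allowed):
    values in [-oo,+oo), upper semicontinuous, and the sub-mean value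
    inequality over every closed ball contained in D. Only values on D
    matter. *)
Definition subharmonic {R : realType} {d : nat}
  (lam : {measure set (BorelRd R d) -> \bar R}) (D : set 'rV[R]_d)
  (u : 'rV[R]_d -> \bar R) : Prop :=
  [/\ (forall x, D x -> (u x < +oo)%E),
      usc_on D u &
      forall (x : 'rV[R]_d) (t : R), 0 < t -> cball x t `<=` D ->
        (u x <= ((fine (lam (cball x t)))^-1)%:E *
                \int[lam]_(y in (cball x t : set (BorelRd R d))) u y)%E].

Definition not_minfty {R : realType} {d : nat} (D : set 'rV[R]_d)
  (h : 'rV[R]_d -> \bar R) : Prop :=
  exists x, D x /\ h x != -oo%E.

Definition usc_reg {R : realType} {d : nat} (D : set 'rV[R]_d)
  (u : 'rV[R]_d -> \bar R) (x : 'rV[R]_d) : \bar R :=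
  ereal_inf [set ereal_sup (u @` (D `&` oball x e)) | e in [set e : R | 0 < e]].

Definition loc_unif_bdd_above {R : realType} {d : nat} (D : set 'rV[R]_d)
  (hs : nat -> 'rV[R]_d -> \bar R) : Prop :=
  forall x, D x -> exists M : R, \forall y \near x, forall k, (hs k y <= M%:E)%E.

(** H (a set of functions, identified through their restrictions to D) is a
    convex cone of subharmonic functions on D containing 0 and -1, closed
    under usc-regularized limsup of locally uniformly bounded above
    sequences. *)
Definition good_cone {R : realType} {d : nat}
  (lam : {measure set (BorelRd R d) -> \bar R}) (D : set 'rV[R]_d)
  (H : set ('rV[R]_d -> \bar R)) : Prop :=
  [/\ (forall h, H h -> subharmonic lam D h),
      (forall h1 h2, H h1 -> H h2 ->
         exists h, H h /\ forall x, D x -> h x = (h1 x + h2 x)%E),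
      (forall (c : R) h, 0 <= c -> H h ->
         exists h', H h' /\ forall x, D x -> h' x = (c%:E * h x)%E),
      ((exists h, H h /\ forall x, D x -> h x = 0%E) /\
       (exists h, H h /\ forall x, D x -> h x = (-1)%:E)) &
      (forall hs : nat -> 'rV[R]_d -> \bar R, (forall k, H (hs k)) ->
         loc_unif_bdd_above D hs ->
         exists h, H h /\ forall x, D x ->
           h x = usc_reg D (fun y => limn_esup (fun k => hs k y)) x)].

Definition Meas0 {R : realType} {d : nat} (D : set 'rV[R]_d)
  (mu : {measure set (BorelRd R d) -> \bar R}) : Prop :=
  (mu setT < +oo)%E /\
  exists K : set 'rV[R]_d, [/\ compact K, K `<=` D &
                              mu (~` K : set (BorelRd R d)) = 0%E].

Definition JH {R : realType} {d : nat}
  (lam : {measure set (BorelRd R d) -> \bar R}) (D : set 'rV[R]_d)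
  (H : set ('rV[R]_d -> \bar R)) (o : 'rV[R]_d) (r : R) :
  set {measure set (BorelRd R d) -> \bar R} :=
  [set mu | Meas0 D mu /\
     forall h, H h ->
       (\int[lam]_(x in (cball o r : set (BorelRd R d))) h x <=
        \int[mu]_(x in (D : set (BorelRd R d))) h x)%E].

Definition int_s {R : realType} {d : nat} (D : set 'rV[R]_d)
  (g : 'rV[R]_d -> R) (h1 h2 : 'rV[R]_d -> \bar R)
  (mu : {measure set (BorelRd R d) -> \bar R}) : \bar R :=
  (\int[mu]_(x in (D : set (BorelRd R d))) (g x)%:E
   + \int[mu]_(x in (D : set (BorelRd R d))) h1 x
   - \int[mu]_(x in (D : set (BorelRd R d))) h2 x)%E.

(* Main.v *)
Require Import Defs.
From HB Require Import structures.
From mathcomp Require Import all_boot all_order all_algebra.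
From mathcomp Require Import all_classical all_reals all_analysis.
From mathcomp Require Import measurable_realfun ring lra.
Import Order.TTheory GRing.Theory Num.Theory.
Import numFieldNormedType.Exports.

Set Implicit Arguments.
Unset Strict Implicit.
Unset Printing Implicit Defensive.

Local Open Scope classical_set_scope.
Local Open Scope ring_scope.

(** Upper bound: if [h <= f] a.e. then [h + h2 <= g + h1] a.e.; averaging over
    small balls the inequality holds everywhere on [D] (the left side has the
    sub-mean value property, the right side is upper semicontinuous), so it can
    be integrated against any [mu] in [J_H].

    Lower bound: on a compact [K] with [B <= K <= D], and for a continuous
    [phi >= h1] on [K], consider the superlinear functional
    [gain (f, tau) = sup {\int_B h | h + tau h2 <= f on K}] on [C(K) * R].
    A linear functional supporting it at [(g + phi, 1)] (Hahn-Banach) has a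
    positive [C(K)]-part, hence is given by a measure [nu] (Riesz) that lies in
    [J_H], and [gain (g + phi, 1) >= \int s dnu].  So there are [h_n] in [H] with
    [h_n + h2 <= g + phi_n] on [K_n] and [\int_B h_n >= m], where [K_n] exhausts
    [D] and the [phi_n] approximate [h1] from above.  The sub-mean value
    inequality and the local integrability of [h2] make [(h_n)] locally bounded
    above; the regularized upper limit [h] lies in [H], satisfies
    [h + h2 <= g + h1] on [D] and, by Fatou's lemma, [\int_B h >= m]. *)

(** The function [g + h1 - h2] is not continuous and may be undefined at some points, so it cannot
    itself be an argument of [gain]. Continuous majorants [phi] take care of [h1]; [h2], being
    subtracted, would call for continuous minorants, which the value [-oo] can exclude. It is kept
    instead as the extra direction [tau]. The coefficient [a] of the supporting functional in that
    direction satisfies [- a <= \int h2 dnu], and this single inequality replaces an approximation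
    of [h2].

    In the limit, the bounds on [h_n + h2] say nothing about [h_n] where [h2 = -oo], so [h_n] is
    estimated through its mean over a ball. The comparison of balls costs a factor [C], but [C]
    multiplies only the difference between an upper bound [M] of [h2] near [x] and a mean of [h2].
    Since that mean is at least [h2 x], taking [M] close to [h2 x] removes the loss, and the limit
    inequality holds at every point of [D]. *)

(** * Hahn-Banach theorem relative to a subspace *)

Section HahnBanach.
Variables (R : realType) (V : lmodType R) (S : set V) (p : V -> R).
Hypothesis S_lin : forall (t : R) x y, S x -> S y -> S (x + t *: y).
Hypothesis p_add : forall x y, S x -> S y -> p (x + y) <= p x + p y.
Hypothesis p_scale : forall (t : R) x, 0 < t -> S x -> p (t *: x) <= t * p x.

Let S0 x : S x -> S 0.
Proof. by move=> Sx; have := S_lin (-1) Sx Sx; rewrite scaleN1r subrr. Qed.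

Let SZ (t : R) x : S x -> S (t *: x).
Proof. by move=> Sx; have := S_lin t (S0 Sx) Sx; rewrite add0r. Qed.

Let SD x y : S x -> S y -> S (x + y).
Proof. by move=> Sx Sy; have := S_lin 1 Sx Sy; rewrite scale1r. Qed.

Let pZ (t : R) x : 0 < t -> S x -> p (t *: x) = t * p x.
Proof.
move=> t0 Sx; apply/eqP; rewrite eq_le p_scale//=.
have := @p_scale t^-1 (t *: x); rewrite invr_gt0 t0 => /(_ isT (SZ t Sx)).
by rewrite scalerA mulVf ?gt_eqF// scale1r ler_pdivlMl.
Qed.

Let p0 x : S x -> p 0 = 0.
Proof.
move=> Sx; have := @pZ 2 0 ltac:(lra) (S0 Sx).
by rewrite scaler0 => ?; lra.
Qed.

(** A partial linear functional is encoded by its graph, so that extension is inclusion.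
    Single-valuedness follows from the bound: differences [(0, c)] and [(0, - c)] both lie in [G],
    and [p 0 = 0]. *)
Let dominated_graph (v : V) (G : set (V * R)) :=
  [/\ G (v, p v),
      (forall t z w, G z -> G w -> G (z.1 + t *: w.1, z.2 + t * w.2)) &
      (forall z, G z -> S z.1 /\ z.2 <= p z.1)].

(** The value [c] at [x0] has to lie between all [z.2 - p (z.1 - x0)] and all [p (w.1 + x0) - w.2].
    Subadditivity of [p] separates the two families, and the supremum of the first one fits. A
    nonzero multiple [t] of [x0] reduces to these two cases through division by [|t|]. *)
Let extend_dominated v G x0 : dominated_graph v G -> S x0 ->
  exists c, dominated_graph v
    [set z | exists w t, G w /\ z = (w.1 + t *: x0, w.2 + t * c)].
Proof.
move=> [Gv Glin Gp] Sx0.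
pose A := [set z.2 - p (z.1 - x0) | z in G].
have SB z : G z -> S (z.1 - x0).
  by move=> /Gp[Sz _]; have := S_lin (-1) Sz Sx0; rewrite scaleN1r.
have SA z : G z -> S (z.1 + x0) by move=> /Gp[Sz _]; exact: SD.
have Aub w : G w -> ubound A (p (w.1 + x0) - w.2).
  move=> Gw _ [z Gz <-]; rewrite lerBlDr addrAC lerBrDr.
  have /Gp[_ /=] := Glin 1 _ _ Gz Gw; rewrite scale1r mul1r => /le_trans; apply.
  rewrite -[z.1](subrK x0) -addrA [x0 + _]addrC addrC.
  by rewrite (le_trans (p_add (SA _ Gw) (SB _ Gz)))// ?subrK.
have supA : has_sup A.
  by split; [exists (p v - p (v - x0)); exists (v, p v)
            | exists (p (v + x0) - p v); exact: (Aub _ Gv)].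
exists (sup A); split.
- exists (v, p v), 0; split => //=; by rewrite scale0r mul0r !addr0.
- move=> t _ _ [z [s [Gz ->]]] [w [u [Gw ->]]] /=.
  exists (z.1 + t *: w.1, z.2 + t * w.2), (s + t * u); split; first exact: Glin.
  congr pair => /=; last by rewrite mulrDl mulrDr mulrA addrACA.
  by rewrite scalerDl scalerDr scalerA addrACA.
- move=> _ [w [t [Gw ->]]] /=; have [Sw wp] := Gp _ Gw.
  split; first exact: S_lin.
  have Gs s : G (s *: w.1, s * w.2).
    have := Glin (s - 1) _ _ Gw Gw.
    by rewrite scalerBl scale1r addrC subrK mulrBl mul1r addrC subrK.
  have [t0|t0|->] := ltgtP t 0; last by rewrite mul0r scale0r !addr0.
  + have s0 : 0 < (- t)^-1 by rewrite invr_gt0 oppr_gt0.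
    have : (- t)^-1 * w.2 - p ((- t)^-1 *: w.1 - x0) <= sup A.
      by apply: ub_le_sup; [case: supA | exists ((- t)^-1 *: w.1, (- t)^-1 * w.2)].
    rewrite -(ler_pM2l (x := - t)) ?oppr_gt0// mulrBr mulrA mulfV ?oppr_eq0 ?lt_eqF//.
    rewrite mul1r -pZ ?oppr_gt0//; last exact: (SB _ (Gs _)).
    rewrite scalerBr scalerA mulfV ?oppr_eq0 ?lt_eqF// scale1r scaleNr opprK.
    by lra.
  + have : sup A <= p (t^-1 *: w.1 + x0) - t^-1 * w.2.
      by apply: ge_sup; [case: supA | exact: (Aub _ (Gs _))].
    rewrite -(ler_pM2l t0) mulrBr mulrA mulfV ?gt_eqF// mul1r.
    rewrite -pZ//; last exact: (SA _ (Gs _)).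
    rewrite scalerDr scalerA mulfV ?gt_eqF// scale1r.
    by lra.
Qed.

Theorem hahn_banach (v : V) : S v ->
  exists L : V -> R,
    [/\ (forall (t : R) x y, S x -> S y -> L (x + t *: y) = L x + t * L y),
        (forall x, S x -> L x <= p x) & L v = p v].
Proof.
move=> Sv.
pose P := [set G | G = set0 \/ dominated_graph v G].
have [|G [PG Gmax]] := @Zorn_bigcup _ P.
  move=> F FP totF.
  have [[X FX Xv]|noX] := pselect (exists2 X, F X & dominated_graph v X); last first.
    left; rewrite -subset0 => z [X FX Xz].
    by case: (FP _ FX) => [X0|Xv]; [rewrite X0 in Xz | case: noX; exists X].
  right; split.
  - by exists X => //; case: Xv.
  - move=> t z w [Y FY Yz] [Z FZ Zw].
    have [Yg Zg] : dominated_graph v Y /\ dominated_graph v Z.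
      split; [case: (FP _ FY) => // Y0 | case: (FP _ FZ) => // Y0].
        by rewrite Y0 in Yz.
      by rewrite Y0 in Zw.
    have [YZ|ZY] := totF _ _ FY FZ.
      by exists Z => //; case: Zg => _ + _; apply => //; exact: YZ.
    by exists Y => //; case: Yg => _ + _; apply => //; exact: ZY.
  - move=> z [Y FY Yz]; case: (FP _ FY) => [Y0|[_ _]]; last exact.
    by rewrite Y0 in Yz.
have line : dominated_graph v [set z | exists t, z = (t *: v, t * p v)].
  split; first by exists 1; rewrite scale1r mul1r.
    move=> t _ _ [s ->] [u ->]; exists (s + t * u) => /=.
    by rewrite scalerDl scalerA mulrDl mulrA.
  move=> _ [t ->] /=; split; first exact: SZ.
  have [t0|t0|->] := ltgtP t 0.
  - have := p_add (SZ t Sv) (SZ (- t) Sv).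
    by rewrite scaleNr subrr (p0 Sv) -scaleNr (@pZ (- t))// ?oppr_gt0// => ?; lra.
  - by rewrite pZ.
  - by rewrite mul0r scale0r (p0 Sv).
have Gg : dominated_graph v G.
  case: PG => // G0; exfalso; apply: (Gmax [set z | exists t, z = (t *: v, t * p v)]).
    split; first by rewrite G0.
    by move=> /(_ (v, p v)); rewrite G0; apply; exists 1; rewrite scale1r mul1r.
  by right.
have Gdom x : S x -> exists a, G (x, a).
  move=> Sx; apply: contrapT => nG.
  have [c Gc] := extend_dominated Gg Sx; apply: (Gmax _ _ (or_intror Gc)).
  split.
    by move=> [y b] Gy; exists (y, b), 0; rewrite scale0r mul0r !addr0.
  move=> sub; apply: nG; exists c; apply: sub.
  case: (Gg) => Gv Glin _; exists (0, 0), 1; rewrite scale1r mul1r !add0r; split => //.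
  have := Glin (-1) _ _ Gv Gv.
  by rewrite /= scaleN1r subrr mulN1r subrr.
case: Gg => Gv Glin Gp.
have Gfun x a b : G (x, a) -> G (x, b) -> a = b.
  move=> Ga Gb; have := Glin (-1) _ _ Ga Gb; have := Glin (-1) _ _ Gb Ga.
  rewrite /= scaleN1r subrr !mulN1r => /Gp[_ /=] + /Gp[_ /=].
  by rewrite (p0 Sv) => ? ?; apply/eqP; rewrite eq_le; apply/andP; split; lra.
have /choice[L LG] : forall x, exists a, S x -> G (x, a).
  move=> x; have [/Gdom[a Ga]|nSx] := pselect (S x); first by exists a.
  by exists 0.
exists L; split.
- move=> t x y Sx Sy; apply: Gfun (Glin t _ _ (LG _ Sx) (LG _ Sy)).
  exact/LG/S_lin.
- by move=> x Sx; have /Gp[] := LG _ Sx.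
- exact: Gfun (LG _ Sv) Gv.
Qed.

End HahnBanach.

(** * Upper semicontinuous functions *)

Lemma lt_real_of_lty {R : realType} (x : \bar R) : (x < +oo)%E -> exists a : R, (x < a%:E)%E.
Proof.
case: x => [s| |]// _; last by exists 0; exact: ltNyr.
by exists (s + 1); rewrite lte_fin ltrDl.
Qed.

Section Semicontinuity.
Context {R : realType} {d : nat}.
Implicit Types (K A : set 'rV[R]_d) (u : 'rV[R]_d -> \bar R).

(** Only neighbours inside [A] count, so the notion passes to subsets and covers functions that are
    merely continuous on a compact set. *)
Definition usc_within A u := forall x, A x -> forall a : R, (u x < a%:E)%E ->
  \forall y \near x, A y -> (u y < a%:E)%E.

Lemma usc_onW A u : usc_on A u -> usc_within A u.
Proof. by move=> uA x Ax a /(uA x Ax a); apply: filterS. Qed.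

Lemma usc_withinS K A u : K `<=` A -> usc_within A u -> usc_within K u.
Proof. by move=> KA uA x /KA Ax a /(uA x Ax a); apply: filterS => y + /KA; apply. Qed.

Lemma within_continuousP K (f : 'rV[R]_d -> R) : {within K, continuous f} <->
  forall x, K x -> forall e, 0 < e -> \forall y \near x, K y -> `|f x - f y| < e.
Proof.
rewrite subspace_continuousP; split=> fK x Kx.
  by move=> e e0; have /cvgrPdist_lt/(_ e e0) := fK x Kx.
by apply/cvgrPdist_lt => e e0; exact: fK.
Qed.

Lemma within_continuous_usc K (f : 'rV[R]_d -> R) :
  {within K, continuous f} -> usc_within K (EFin \o f).
Proof.
move=> /within_continuousP fK x Kx a; rewrite /= lte_fin -subr_gt0 => a0.
apply: filterS (fK x Kx _ a0) => y + Ky => /(_ Ky); rewrite /= lte_fin.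
by rewrite ltr_norml => /andP[] ? ?; lra.
Qed.

Lemma open_measurable_Rd A : open A -> measurable (A : set (BorelRd R d)).
Proof. exact: sub_sigma_algebra. Qed.

Lemma closed_measurable_Rd A : closed A -> measurable (A : set (BorelRd R d)).
Proof.
by move=> /closed_openC/open_measurable_Rd/measurableC; rewrite setCK.
Qed.

Lemma compact_measurable_Rd K : compact K -> measurable (K : set (BorelRd R d)).
Proof. by move=> cK; apply: closed_measurable_Rd; apply: compact_closed => //; exact: norm_hausdorff. Qed.

(** Superlevel sets are [A] minus the open set [O] of points around which [u < a] holds on [A]. *)
Lemma usc_within_measurable A u : measurable (A : set (BorelRd R d)) ->
  usc_within A u -> measurable_fun (A : set (BorelRd R d)) u.
Proof.
move=> mA uA _; apply: (measurability _ (ErealGenCInfty.measurableE R)) => //.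
move=> _ [_ [a ->] <-].
pose O := [set x : 'rV[R]_d | \forall y \near x, A y -> (u y < a%:E)%E].
have -> : A `&` u @^-1` `[a%:E, +oo[%classic = A `\` O.
  apply/seteqP; split => x /=; rewrite in_itv/= andbT => -[Ax].
    by move=> ax; split => // /nbhs_singleton/(_ Ax); rewrite ltNge ax.
  by move=> nO; split => //; rewrite leNgt; apply/negP => /(uA x Ax).
apply: measurableD => //; apply: open_measurable_Rd.
by rewrite openE => x Ox; apply: nbhs_interior.
Qed.

(** The common core of Dini's theorem and of the boundedness of semicontinuous functions: local
    ranks become one global rank through the near-covering form of compactness. *)
Lemma compact_nat_cover K (U : nat -> set 'rV[R]_d) : compact K ->
  (forall x, K x -> exists n, \forall y \near x, K y ->
     forall m, (n <= m)%N -> U m y) ->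
  exists n, K `<=` U n.
Proof.
move=> /compact_near_coveringP/near_covering_withinP cK KU.
suff [n _ /(_ n)] : \forall n \near \oo, K `<=` U n by move=> /(_ (leqnn n)); exists n.
apply: cK => x /KU[n nU].
exists ([set y | K y -> forall m, (n <= m)%N -> U m y], [set m | (n <= m)%N]).
  by split => //=; exists n.
by move=> [y m] /= [yU nm] Ky; exact: yU.
Qed.

Lemma usc_compact_bounded K u : compact K -> usc_within K u ->
  (forall x, K x -> (u x < +oo)%E) -> exists2 M : R, 0 <= M & forall x, K x -> (u x <= M%:E)%E.
Proof.
move=> cK uK uoo.
have [x Kx|n nK] := @compact_nat_cover K (fun n y => (u y <= n%:R%:E)%E) cK.
  have [a ua] := lt_real_of_lty (uoo x Kx).
  exists (Num.truncn a).+1; apply: filterS (uK x Kx a ua) => y + Ky m nm => /(_ Ky) /ltW ya.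
  rewrite (le_trans ya)// lee_fin (le_trans (ltW (truncnS_gt a)))//.
  by rewrite ler_nat.
by exists n%:R => // x /nK.
Qed.

Lemma lipschitz_continuous (f : 'rV[R]_d -> R) (N : R) : 0 <= N ->
  (forall x y, f x <= f y + N * `|x - y|) -> continuous f.
Proof.
move=> N0 fN x; suff : f @ nbhs x --> f x by [].
apply/cvgrPdist_lt => e e0.
have N10 : 0 < N + 1 by lra.
have eN : 0 < e / (N + 1) by rewrite divr_gt0.
near=> y.
have xy : `|x - y| < e / (N + 1) by near: y; exact: cvgr_dist_lt.
have yx := distrC x y.
have fxy := fN x y; have fyx := fN y x.
have : (N + 1) * `|x - y| < e by rewrite mulrC -ltr_pdivlMr.
rewrite mulrDl mul1r => lt_e; have n0 := normr_ge0 (x - y).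
by rewrite ltr_norml; apply/andP; split; rewrite -yx in fyx; lra.
Unshelve. all: by end_near. Qed.

(** For [K] nonempty, [w] bounded above on [K] and [N >= 0], this is the least [N]-Lipschitz
    majorant of [w] on [K]. For [w = 0] and [N = 1] it is minus the distance to [K]. *)
Definition sup_convolution K (w : 'rV[R]_d -> R) (N : R) (x : 'rV[R]_d) : R :=
  sup [set w y - N * `|x - y| | y in K].

Section SupConvolution.
Variables (K : set 'rV[R]_d) (w : 'rV[R]_d -> R) (N M : R).
Hypotheses (N0 : 0 <= N) (K0 : K !=set0) (wM : forall y, K y -> w y <= M).

Let has_sup_conv x : has_sup [set w y - N * `|x - y| | y in K].
Proof.
split; first by case: K0 => y Ky; exists (w y - N * `|x - y|); exists y.
exists M => _ [y Ky <-]; rewrite lerBlDr (le_trans (wM Ky))// lerDl.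
by rewrite mulr_ge0.
Qed.

Lemma sup_convolution_ge x y : K y -> w y - N * `|x - y| <= sup_convolution K w N x.
Proof. by move=> Ky; apply: ub_le_sup; [case: (has_sup_conv x)|exists y]. Qed.

Lemma sup_convolution_le x a :
  (forall y, K y -> w y - N * `|x - y| <= a) -> sup_convolution K w N x <= a.
Proof. by move=> le_a; apply: ge_sup; [case: (has_sup_conv x)|move=> _ [y Ky <-]; exact: le_a]. Qed.

Lemma sup_convolution_continuous : continuous (sup_convolution K w N).
Proof.
apply: (@lipschitz_continuous _ N) => // x z.
apply: sup_convolution_le => y Ky; have := sup_convolution_ge z Ky.
have : `|z - y| <= `|x - y| + `|x - z|.
  by rewrite (distrC x z) [leRHS]addrC; exact: ler_distD.
by move=> /(ler_wpM2l N0); rewrite mulrDr => ? ?; lra.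
Qed.

End SupConvolution.

(* [phi] is the sup-convolution of [max u (-n)] with slope [n (M + 1)], [M] an
   upper bound of [u]: points at distance [>= delta] then contribute at most
   [- n delta]. *)
Lemma usc_approx K u (n : nat) : compact K -> K !=set0 -> usc_within K u ->
  (forall x, K x -> (u x < +oo)%E) ->
  exists phi : 'rV[R]_d -> R, [/\ continuous phi,
    (forall x, K x -> (u x <= (phi x)%:E)%E) &
    forall x (delta a : R), 1 <= n%:R * delta -> - (n%:R * delta) <= a ->
      - n%:R <= a -> (forall y, K y -> `|x - y| < delta -> (u y <= a%:E)%E) ->
      phi x <= a].
Proof.
move=> cK K0 uK uoo.
have [M M0 uM] := usc_compact_bounded cK uK uoo.
pose w y := fine (maxe (u y) (- n%:R)%:E).
have wE y : K y -> (w y)%:E = maxe (u y) (- n%:R)%:E.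
  move=> Ky; rewrite fineK// fin_numE; apply/andP; split.
    by rewrite -ltNye lt_max ltNyr orbT.
  by rewrite -ltey gt_max uoo//= ltry.
have wM y : K y -> w y <= M.
  move=> Ky; rewrite -lee_fin wE// ge_max uM//= lee_fin.
  by rewrite (@le_trans _ _ 0)// oppr_le0.
have N0 : 0 <= n%:R * (M + 1) by rewrite mulr_ge0// addr_ge0.
exists (sup_convolution K w (n%:R * (M + 1))); split.
- exact: sup_convolution_continuous N0 K0 wM.
- move=> x Kx; have := sup_convolution_ge N0 K0 wM x Kx.
  rewrite subrr normr0 mulr0 subr0 => h; apply: le_trans (_ : ((w x)%:E <= _)%E).
    by rewrite wE// le_max lexx.
  by rewrite lee_fin.
- move=> x delta a nd na na' ua; apply: (sup_convolution_le N0 K0 wM) => y Ky.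
  have [xy|xy] := ltP `|x - y| delta.
    rewrite lerBlDr (@le_trans _ _ a)//; last by rewrite lerDl mulr_ge0.
    by rewrite -lee_fin wE// ge_max ua//= lee_fin.
  have := wM _ Ky.
  have : n%:R * (M + 1) * delta <= n%:R * (M + 1) * `|x - y| by rewrite ler_wpM2l.
  have : 0 <= M * (n%:R * delta - 1) by rewrite mulr_ge0// subr_ge0.
  rewrite mulrBr mulr1 mulrDr mulr1 !mulrDl.
  by rewrite [M * _]mulrCA [_ * M * delta]mulrAC -[n%:R * delta * M]mulrA [delta * M]mulrC; lra.
Qed.

End Semicontinuity.

(** * Algebra of functions continuous on a set *)

Section WithinContinuity.
Context {R : realType} {d : nat} (K : set 'rV[R]_d).
Implicit Types f g : 'rV[R]_d -> R.
Local Notation C f := {within K, continuous (f : 'rV[R]_d -> R)}.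

Lemma within_continuous_cst (c : R) : C (fun=> c).
Proof. by apply/within_continuousP => x _ e e0; near=> y => _; rewrite subrr normr0.
Unshelve. all: by end_near. Qed.

Lemma within_continuous_lin (t : R) f g : C f -> C g -> C (fun x => f x + t * g x).
Proof.
by move=> cf cg x; apply: cvgD; [exact: cf|apply: cvgM; [exact: cvg_cst|exact: cg]].
Qed.

Lemma within_continuousD f g : C f -> C g -> C (fun x => f x + g x).
Proof. by move=> cf cg x; apply: cvgD; [exact: cf|exact: cg]. Qed.

Lemma within_continuousM f g : C f -> C g -> C (fun x => f x * g x).
Proof. by move=> cf cg x; apply: cvgM; [exact: cf|exact: cg]. Qed.

Lemma within_continuous_min f g : C f -> C g -> C (fun x => Num.min (f x) (g x)).
Proof. by move=> cf cg x; apply: continuous_min; [exact: cf|exact: cg]. Qed.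

Lemma within_continuous_max f g : C f -> C g -> C (fun x => Num.max (f x) (g x)).
Proof. by move=> cf cg x; apply: continuous_max; [exact: cf|exact: cg]. Qed.

Lemma within_continuous_sum n (F : nat -> 'rV[R]_d -> R) : (forall i, C (F i)) ->
  C (fun x => \sum_(i < n) F i x).
Proof.
move=> cF; elim: n => [|n IH].
  by rewrite (_ : (fun _ => _) = fun=> 0); [exact: within_continuous_cst|
    apply/funext => x; rewrite big_ord0].
rewrite (_ : (fun _ => _) = fun x => \sum_(i < n) F i x + 1 * F n x).
  exact: within_continuous_lin.
by apply/funext => x; rewrite big_ord_recr/= mul1r.
Qed.

Lemma within_continuous_bounded f : compact K -> C f ->
  exists2 M, 0 <= M & forall x, K x -> `|f x| <= M.
Proof.
move=> cK cf; have cNf : C (fun x => - f x) by move=> x; apply: cvgN; exact: cf.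
have [M1 M10 fM1] := usc_compact_bounded cK (within_continuous_usc cf) (fun x _ => ltry (f x)).
have [M2 M20 fM2] := usc_compact_bounded cK (within_continuous_usc cNf) (fun x _ => ltry (- f x)).
exists (M1 + M2); first exact: addr_ge0.
move=> x Kx; have := fM1 x Kx; have := fM2 x Kx; rewrite !lee_fin ler_norml => ? ?.
by apply/andP; split; lra.
Qed.

End WithinContinuity.
Arguments within_continuous_cst {R d} K c.
Arguments within_continuous_lin {R d K} t [f g].

(** * Riesz representation of a positive functional on [C(K)] *)

Section Riesz.
Context {R : realType} {d : nat} (K : set 'rV[R]_d) (cK : compact K).
Variable ell : ('rV[R]_d -> R) -> R.
Local Notation C f := {within K, continuous (f : 'rV[R]_d -> R)}.
Hypothesis ell_lin : forall (t : R) (f g : 'rV[R]_d -> R), C f -> C g ->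
  ell (fun x => f x + t * g x) = ell f + t * ell g.
Hypothesis ell_ge0 : forall f : 'rV[R]_d -> R, C f -> (forall x, K x -> 0 <= f x) -> 0 <= ell f.

Let ell_le (f g : 'rV[R]_d -> R) : C f -> C g -> (forall x, K x -> f x <= g x) -> ell f <= ell g.
Proof.
move=> cf cg fg; have := ell_ge0 (within_continuous_lin (-1) cg cf).
rewrite ell_lin// mulN1r subr_ge0; apply => x /fg.
by rewrite mulN1r subr_ge0.
Qed.

Let ell0 : ell (fun=> 0) = 0.
Proof.
have := ell_lin (-1) (within_continuous_cst K 0) (within_continuous_cst K 0).
by rewrite !mulN1r !subrr.
Qed.

Let ellZ (t : R) (f : 'rV[R]_d -> R) : C f -> ell (fun x => t * f x) = t * ell f.
Proof.
move=> cf; have := ell_lin t (within_continuous_cst K 0) cf; rewrite ell0 add0r => <-.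
by congr ell; apply/funext => x; rewrite add0r.
Qed.

Let ellD (f g : 'rV[R]_d -> R) : C f -> C g -> ell (fun x => f x + g x) = ell f + ell g.
Proof.
move=> cf cg; have := ell_lin 1 cf cg; rewrite mul1r => <-.
by congr ell; apply/funext => x; rewrite mul1r.
Qed.

Let ell_sum n (F : nat -> 'rV[R]_d -> R) : (forall i, C (F i)) ->
  ell (fun x => \sum_(i < n) F i x) = \sum_(i < n) ell (F i).
Proof.
move=> cF; elim: n => [|n IH].
  by rewrite big_ord0 -[RHS]ell0; congr ell; apply/funext => x; rewrite big_ord0.
rewrite big_ord_recr/= -IH -ellD//; last exact: within_continuous_sum.
by congr ell; apply/funext => x; rewrite big_ord_recr.
Qed.

Let C1 : C (fun=> 1) := within_continuous_cst K 1.

(** A Daniell-type outer measure: [A] is covered by an increasing sequence of nonnegative continuous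
    functions. Sequences, rather than single functions, give countable subadditivity. As only points
    of [K] enter, the complement of [K] will be null. *)
Definition riesz_cover (A : set 'rV[R]_d) : set R := [set c |
  exists psi : nat -> 'rV[R]_d -> R, [/\ (forall n, C (psi n)),
    (forall n x, K x -> 0 <= psi n x),
    (forall n m x, K x -> (n <= m)%N -> psi n x <= psi m x),
    (forall x, K x -> A x -> exists n, 1 <= psi n x) &
    (forall n, ell (psi n) <= c)]].

Definition riesz_outer (A : set 'rV[R]_d) : \bar R :=
  ereal_inf [set c%:E | c in riesz_cover A].
Local Notation mu := riesz_outer.

Let mu_le A c : riesz_cover A c -> (mu A <= c%:E)%E.
Proof. by move=> Ac; apply: ereal_inf_lbound; exists c. Qed.

Let cover1 A (f : 'rV[R]_d -> R) : C f -> (forall x, K x -> 0 <= f x) ->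
  (forall x, K x -> A x -> 1 <= f x) -> riesz_cover A (ell f).
Proof. by move=> cf f0 f1; exists (fun=> f); split => // x Kx Ax; exists 0%N; exact: f1. Qed.

Let mu_ge0 A : (0 <= mu A)%E.
Proof.
apply: le_ereal_inf_tmp => _ [c [psi [cpsi psi0 _ _ psic]] <-].
by rewrite lee_fin; apply: le_trans (psic 0%N); apply: ell_ge0 => // x; exact: psi0.
Qed.

Let mu0 : mu set0 = 0%E.
Proof.
apply/eqP; rewrite eq_le mu_ge0 andbT; apply: mu_le; rewrite -ell0.
by apply: cover1 => //; exact: within_continuous_cst.
Qed.

Let mu_fin A : mu A \is a fin_num.
Proof.
rewrite ge0_fin_numE//; apply: (@le_lt_trans _ _ (ell (fun=> 1))%:E); last exact: ltry.
by apply: mu_le; apply: cover1.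
Qed.

Let mu_mono : {homo mu : A B / A `<=` B >-> (A <= B)%E}.
Proof.
move=> A B AB; apply: ereal_inf_le_tmp => _ [c [psi [? ? ? psi1 ?]] <-].
by exists c => //; exists psi; split => // x Kx /AB; exact: psi1.
Qed.

(** Each [F i] has a cover of cost at most [mu (F i) + e / 2^(i+1)]; the triangular sums of
    [psi i m] over [i <= m] increase with [m] and cover the union. *)
Let mu_sigma_subadditive : sigma_subadditive mu.
Proof.
move=> F; apply/lee_addgt0Pr => e e0.
apply: le_trans (epsilon_trick _ (fun n => mu_ge0 (F n)) (ltW e0)).
pose a (i : nat) : R := e / (2 ^ i.+1)%:R.
have a0 i : 0 < a i by rewrite divr_gt0// ltr0n expn_gt0.
have aE0 i : (0 <= mu (F i) + (a i)%:E)%E by rewrite adde_ge0// lee_fin ltW.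
have /choice[c cP] : forall i, exists c, riesz_cover (F i) c /\
    (c%:E <= mu (F i) + (a i)%:E)%E.
  move=> i; have [_ [c Fc <-] /ltW ca] := lb_ereal_inf_adherent (a0 i) (mu_fin (F i)).
  by exists c.
have /choice[psi psiP] := fun i => (cP i).1.
move: (nneseries_ge0 (P := xpredT) (N := 0) (fun i _ _ => aE0 i)).
case E : (limn _) => [s| |]// _; last by rewrite leey.
apply: mu_le; exists (fun m x => \sum_(i < m.+1) psi i m x); split.
- by move=> m; apply: (@within_continuous_sum _ _ K m.+1 (fun i => psi i m)) => i; case: (psiP i).
- by move=> n x Kx; apply: sumr_ge0 => i _; case: (psiP i) => _ + _ _ _; exact.
- move=> n m x Kx nm.
  rewrite -(big_mkord xpredT (fun i => psi i n x)) -(big_mkord xpredT (fun i => psi i m x)).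
  rewrite [leRHS](big_cat_nat (n := n.+1))//=.
  apply: ler_wpDr.
    by apply: sumr_ge0 => i _; case: (psiP i) => _ + _ _ _; exact.
  by apply: ler_sum => i _; case: (psiP i) => _ _ + _ _; exact.
- move=> x Kx [i _ Fx]; have [_ p0 pm /(_ x Kx Fx)[n pn] _] := psiP i.
  exists (maxn n i); have iM : (i < (maxn n i).+1)%N by rewrite ltnS leq_maxr.
  rewrite (bigD1 (Ordinal iM))//=; apply: ler_wpDr.
    by apply: sumr_ge0 => j _; case: (psiP j) => _ + _ _ _; exact.
  by rewrite (le_trans pn)// pm// leq_maxl.
- move=> n; rewrite (@ell_sum n.+1 (fun i => psi i n)); last by move=> i; case: (psiP i).
  rewrite -lee_fin -E; apply: le_trans (nneseries_lim_ge n.+1 _); last by [].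
  rewrite -sumEFin big_mkord; apply: lee_sum => i _.
  by apply: le_trans (cP i).2; rewrite lee_fin; case: (psiP i).
Qed.

HB.instance Definition _ := isOuterMeasure.Build R 'rV[R]_d mu mu0 mu_ge0
  mu_mono mu_sigma_subadditive.

(** With [psi] the distance to the complement of [U], the functions [theta n = min 1 (n psi)]
    increase to the indicator of [U] and split a cover [f] of [X]: [f n * theta n] covers the part
    inside [U], and [f n * (1 - theta m)], for a fixed [m], the part outside. The whole space is set
    apart, its complement being empty. *)
Let open_caratheodory (U : set 'rV[R]_d) : open U -> mu.-caratheodory U.
Proof.
move=> oU; have [U0|/set0P U0] := eqVneq (~` U) set0.
  by rewrite -[U]setCK U0; apply/caratheodory_measurable_setC/caratheodory_measurable_set0.
pose psi x := - sup_convolution (~` U) (fun=> 0) 1 x : R.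
have w0 : forall y : 'rV[R]_d, (~` U) y -> (0 : R) <= 0 by [].
have cpsi : C psi.
  apply: continuous_subspaceT => x; apply: continuousN.
  apply: (sup_convolution_continuous ler01 U0 w0).
have psi0 x : 0 <= psi x.
  rewrite oppr_ge0; apply: (sup_convolution_le ler01 U0 w0) => y _.
  by rewrite mul1r sub0r oppr_le0.
have psiC x : ~ U x -> psi x = 0.
  move=> Ux; apply/eqP; rewrite eq_le psi0 andbT oppr_le0.
  have := sup_convolution_ge ler01 U0 w0 x (Ux : (~` U) x).
  by rewrite subrr normr0 mulr0 subr0.
have psiU x : U x -> 0 < psi x.
  move=> Ux; have /nbhs_ballP[e /= e0 eU] : nbhs x U by exact: open_nbhs_nbhs.
  apply: (lt_le_trans e0); rewrite lerNr.
  apply: (sup_convolution_le ler01 U0 w0) => y nUy.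
  rewrite mul1r sub0r lerN2 leNgt; apply/negP => xy; apply: nUy; apply: eU.
  by rewrite -ball_normE.
pose theta n x : R := Num.min 1 (n%:R * psi x).
have ctheta n : C (theta n).
  apply: within_continuous_min => //; apply: within_continuousM => //.
  exact: within_continuous_cst.
have theta01 n x : 0 <= theta n x <= 1.
  by rewrite ge_min lexx le_min ler01/= mulr_ge0.
have thetam n m x : (n <= m)%N -> theta n x <= theta m x.
  move=> nm; rewrite le_min ge_min lexx/= ge_min; apply/orP; right.
  by rewrite ler_wpM2r// ler_nat.
have thetaU x : U x -> exists n, theta n x = 1.
  move=> /psiU p0; exists (Num.truncn (psi x)^-1).+1; apply/min_idPl.
  by rewrite -ler_pdivrMr// mul1r ltW// truncnS_gt.
apply: le_caratheodory_measurable => X; apply: le_ereal_inf_tmp.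
move=> _ [c [f [cf f0 fm f1 fc]] <-].
have mono2 n m k l x : K x -> (n <= m)%N -> (k <= l)%N ->
    f n x * theta k x <= f m x * theta l x.
  move=> Kx nm kl; have /andP[t0 _] := theta01 k x.
  by apply: ler_pM => //; [exact: f0|exact: fm|exact: thetam].
have cft n k : C (fun x => f n x * theta k x) by exact: within_continuousM.
have ftc n k : ell (fun x => f n x * theta k x) <= c.
  apply: le_trans (fc n); apply: ell_le => // x Kx.
  by rewrite ler_piMr ?f0//; case/andP: (theta01 k x).
pose S := [set ell (fun x => f n x * theta n x) | n in setT].
have supS : has_sup S.
  by split; [exists (ell (fun x => f 0%N x * theta 0%N x)); exists 0%N
            |exists c => _ [n _ <-]; exact: ftc].
have muU : (mu (X `&` U) <= (sup S)%:E)%E.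
  apply: mu_le; exists (fun n x => f n x * theta n x); split => //.
  - by move=> n x Kx; rewrite mulr_ge0 ?f0//; case/andP: (theta01 n x).
  - by move=> n m x Kx nm; exact: mono2.
  - move=> x Kx [Xx Ux]; have [n fn] := f1 x Kx Xx; have [k tk] := thetaU x Ux.
    exists (maxn n k); apply: le_trans (mono2 _ _ _ _ _ Kx (leq_maxl n k) (leq_maxr n k)).
    by rewrite tk mulr1.
  - by move=> n; apply: ub_le_sup; [case: supS|exists n].
apply/lee_addgt0Pr => e e0.
have [_ [m _ <-] /ltW mS] := sup_adherent e0 supS.
(* With [m] frozen the cost stays below [c - sup S + e]: for [n >= m] because [ell (f n * theta m)]
   is at least [ell (f m * theta m)], for [n <= m] by comparison with rank [m]. *)
have muC : (mu (X `&` ~` U) <= (c - sup S + e)%:E)%E.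
  apply: mu_le; exists (fun n x => f n x + -1 * (f n x * theta m x)); split.
  - by move=> n; apply: within_continuous_lin.
  - move=> n x Kx; rewrite mulN1r subr_ge0 ler_piMr ?f0//.
    by case/andP: (theta01 m x).
  - move=> n k x Kx nk; rewrite !mulN1r -[X in X - _ <= _]mulr1.
    rewrite -[X in _ <= X - _]mulr1 -!mulrBr ler_wpM2r ?fm// subr_ge0.
    by case/andP: (theta01 m x).
  - move=> x Kx [Xx nUx]; have [n fn] := f1 x Kx Xx; exists n.
    by rewrite /theta psiC// mulr0 min_r ?ler01// mulr0 mulr0 addr0.
  - move=> n; rewrite ell_lin//.
    have [nm|/ltnW mn] := leqP m n.
      have : ell (fun x => f m x * theta m x) <= ell (fun x => f n x * theta m x).
        by apply: ell_le => // x Kx; exact: mono2.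
      by have := fc n; lra.
    have -> : ell (f n) + -1 * ell (fun x => f n x * theta m x) =
        ell (fun x => f n x + -1 * (f n x * theta m x)) by rewrite ell_lin.
    apply: (@le_trans _ _ (ell (fun x => f m x + -1 * (f m x * theta m x)))).
      apply: ell_le => [||x Kx]; try exact: within_continuous_lin.
      rewrite !mulN1r -[X in X - _ <= _]mulr1.
      rewrite -[X in _ <= X - _]mulr1 -!mulrBr ler_wpM2r ?fm// subr_ge0.
      by case/andP: (theta01 m x).
    by rewrite ell_lin//; have := fc m; lra.
apply: (le_trans (leeD muU muC)).
by rewrite -!EFinD lee_fin; lra.
Qed.

Let borel_caratheodory (A : set (BorelRd R d)) : measurable A -> mu.-caratheodory A.
Proof.
apply: smallest_sub => [|U]; last exact: open_caratheodory.
split.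
- exact: caratheodory_measurable_set0.
- by move=> B mB; rewrite setTD; exact: caratheodory_measurable_setC.
- by move=> B mB; exact: caratheodory_measurable_bigcup.
Qed.

Definition riesz_measure : set (BorelRd R d) -> \bar R := mu.
Local Notation m := riesz_measure.

Let riesz_sigma_additive : semi_sigma_additive m.
Proof.
move=> F mF tF mUF; apply: (@caratheodory_measure_sigma_additive R _ mu) => //.
  by move=> i; exact: borel_caratheodory.
exact: borel_caratheodory.
Qed.

HB.instance Definition _ := isMeasure.Build _ _ _ m mu0 mu_ge0 riesz_sigma_additive.

Let mK : measurable (K : set (BorelRd R d)) := compact_measurable_Rd cK.

(** The lower bound is Dini's theorem: a cover of [K] exceeds [1 - e'] on all of [K] at a single
    rank, so its cost is at least [1 - e'] times [ell 1]. *)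
Let riesz_measureK : m K = (ell (fun=> 1))%:E.
Proof.
apply/eqP; rewrite eq_le; apply/andP; split; first by apply: mu_le; apply: cover1.
apply: le_ereal_inf_tmp => _ [c [psi [cpsi psi0 psim psi1 psic]] <-].
rewrite lee_fin; apply/ler_addgt0Pr => e e0.
have l0 : 0 <= ell (fun=> 1) by exact: ell_ge0.
(* The [+ 1] guards against [ell 1 = 0]; in all cases [e' * ell 1 <= e]. *)
pose e' := e / (ell (fun=> 1) + 1).
have e'0 : 0 < e' by rewrite divr_gt0// ltr_pwDr.
have [x Kx|n nK] := @compact_nat_cover _ _ K (fun n y => 1 - e' <= psi n y) cK.
  have [n psin] := psi1 x Kx Kx.
  have /within_continuousP/(_ x Kx e' e'0) := cpsi n.
  move=> near_psi; exists n; apply: filterS near_psi => y + Ky k nk => /(_ Ky).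
  by rewrite ltr_norml => /andP[_]; have := psim n k y Ky nk; lra.
have : ell (fun=> (1 - e') * 1) <= ell (psi n).
  by apply: ell_le => // [|x /nK]; [exact: within_continuous_cst|rewrite mulr1].
rewrite ellZ// => lepsi; have := psic n.
have : e' * ell (fun=> 1) <= e.
  by rewrite /e' mulrAC ler_pdivrMr ?ltr_pwDr// ler_wpM2l ?ltW// ltrDl.
by rewrite mulrBl mul1r in lepsi; lra.
Qed.

Let measurable_C (f : 'rV[R]_d -> R) : C f ->
  measurable_fun (K : set (BorelRd R d)) (fun x => (f x)%:E).
Proof. by move=> cf; apply: usc_within_measurable => //; exact: within_continuous_usc. Qed.

(* One layer [min f e] of [f] is peeled off at a time: it is at least [e] on
   [f > e], so [ell] of it dominates [e * m (f > e)]. *)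
Let integral_layers (e : R) (j : nat) (f : 'rV[R]_d -> R) : 0 < e -> C f ->
  (forall x, K x -> 0 <= f x <= j%:R * e) ->
  (\int[m]_(x in (K : set (BorelRd R d))) (Num.max (f x - e) 0)%:E <= (ell f)%:E)%E.
Proof.
move=> e0; elim: j f => [|j IH] f cf fj.
  rewrite integral0_eq => [|x Kx].
    by rewrite lee_fin; apply: ell_ge0 => // x /fj/andP[].
  by rewrite max_r//; have /andP[] := fj x Kx; rewrite mul0r; lra.
pose f' x := Num.max (f x - e) 0.
have cf' : C f'.
  apply: within_continuous_max; last exact: within_continuous_cst.
  by apply: within_continuousD => //; exact: within_continuous_cst.
pose f1 x := Num.min (f x) e.
have cf1 : C f1 by apply: within_continuous_min => //; exact: within_continuous_cst.
have f'0 x : 0 <= f' x by rewrite le_max lexx orbT.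
have fE : ell f = ell f' + ell f1.
  rewrite -ellD//; apply/eqP; rewrite eq_le; apply/andP; split; apply: ell_le => //;
    try exact: within_continuousD;
    by move=> x _; rewrite /f' /f1; case: (lerP (f x) e) => fe; case: (lerP 0 (f x - e)) => fe'; lra.
pose E := K `\` [set x | (f x)%:E < e%:E]%E.
have mE : measurable (E : set (BorelRd R d)).
  rewrite (_ : E = K `&` (fun x => (f x)%:E) @^-1` `[e%:E, +oo[%classic); last first.
    by apply/seteqP; split => x [Kx] /=; rewrite in_itv/= andbT leNgt => /negP.
  by apply: (measurable_C cf) => //; exact: emeasurable_itv.
pose f2 x := Num.max (f' x - e) 0; pose f3 x := Num.min (f' x) e.
have cf2 : C f2.
  apply: within_continuous_max; last exact: within_continuous_cst.
  by apply: within_continuousD => //; exact: within_continuous_cst.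
have cf3 : C f3 by apply: within_continuous_min => //; exact: within_continuous_cst.
(* The integrand lags by one layer: [f3] vanishes off [E], the part of [K] where [f >= e] and thus
   [f1 = e], so [\int f3 <= e * m E <= ell f1]. This is why the statement bounds the integral of the
   positive part of [f - e] and not that of [f]. *)
have -> : (\int[m]_(x in (K : set (BorelRd R d))) (f' x)%:E =
    \int[m]_(x in (K : set (BorelRd R d))) ((f2 x)%:E + (f3 x)%:E))%E.
  apply: eq_integral => x _; rewrite -EFinD; congr EFin; rewrite /f2 /f3.
  by case: (lerP (f' x) e) => fe; case: (lerP 0 (f' x - e)) => fe'; lra.
rewrite ge0_integralD//; last 4 first.
- by move=> x _; rewrite lee_fin le_max lexx orbT.
- exact: measurable_C.
- by move=> x _; rewrite lee_fin le_min f'0 ltW.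
- exact: measurable_C.
rewrite fE EFinD; apply: leeD.
  apply: IH => // x Kx; rewrite f'0/= ge_max.
  have /andP[_] := fj x Kx; rewrite -natr1 mulrDl mul1r => ?.
  by apply/andP; split; [lra | rewrite mulr_ge0// ltW].
apply: (@le_trans _ _ (\int[m]_(x in (K : set (BorelRd R d))) (e%:E * (\1_E x)%:E))%E).
  apply: ge0_le_integral => //.
  - by move=> x _; rewrite lee_fin le_min f'0 ltW.
  - exact: measurable_C.
  - apply: measurable_funeM; apply/measurable_EFinP.
    exact: measurable_indic.
  - move=> x Kx; rewrite -EFinM lee_fin indicE.
    have [xE|nxE] := boolP (x \in E); first by rewrite mulr1 ge_min lexx orbT.
    rewrite mulr0 ge_min; apply/orP; left; rewrite ge_max lexx andbT subr_le0 leNgt.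
    apply/negP => ef; move/negP: nxE; apply; rewrite inE; split => //=.
    by rewrite lte_fin => /(lt_trans ef); rewrite ltxx.
rewrite ge0_integralZl_EFin ?(ltW e0)//; last first.
  by apply/measurable_EFinP; exact: measurable_indic.
rewrite integral_indic// (_ : E `&` K = E); last by apply/setIidl => x [].
have -> : ell f1 = e * ell (fun x => e^-1 * f1 x) by rewrite ellZ// mulrA mulfV ?gt_eqF// mul1r.
rewrite EFinM lee_pmul2l//; apply: mu_le; apply: cover1.
- by apply: within_continuousM => //; exact: within_continuous_cst.
- move=> x Kx; apply: mulr_ge0; first by rewrite invr_ge0 ltW.
  by rewrite le_min (ltW e0) andbT; case/andP: (fj x Kx).
- move=> x Kx [_ /=]; rewrite lte_fin => /negP; rewrite -leNgt => ef.
  by rewrite /f1 min_r// mulVf// gt_eqF.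
Qed.

(** Cutting [f] into layers of height [e'] loses at most [e' * m K = e' * ell 1 <= e]. *)
Let integral_le_ell (f : 'rV[R]_d -> R) : C f -> (forall x, K x -> 0 <= f x) ->
  (\int[m]_(x in (K : set (BorelRd R d))) (f x)%:E <= (ell f)%:E)%E.
Proof.
move=> cf f0; apply/lee_addgt0Pr => e e0.
have l0 : 0 <= ell (fun=> 1) by exact: ell_ge0.
pose e' := e / (ell (fun=> 1) + 1).
have e'0 : 0 < e' by rewrite divr_gt0// ltr_pwDr.
have [M M0 fM] := usc_compact_bounded cK (within_continuous_usc cf) (fun x _ => ltry (f x)).
pose j := (Num.truncn (M / e')).+1.
have Mj : M <= j%:R * e' by rewrite -ler_pdivrMr// ltW// truncnS_gt.
have := @integral_layers e' j f e'0 cf.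
move=> /(_ _)/le_trans le_layers.
pose f2 x := Num.max (f x - e') 0.
have cf2 : C f2.
  apply: within_continuous_max; last exact: within_continuous_cst.
  by apply: within_continuousD => //; exact: within_continuous_cst.
apply: (@le_trans _ _ (\int[m]_(x in (K : set (BorelRd R d))) ((f2 x)%:E + e'%:E))%E).
  apply: ge0_le_integral => //.
  - exact: measurable_C.
  - by apply: emeasurable_funD; [exact: measurable_C|exact: measurable_cst].
  - move=> x Kx; rewrite -EFinD lee_fin /f2; have := f0 x Kx.
    by case: (lerP 0 (f x - e')); lra.
rewrite ge0_integralD//; last 3 first.
- by move=> x _; rewrite lee_fin le_max lexx orbT.
- exact: measurable_C.
- by move=> x _; rewrite lee_fin ltW.
apply: leeD.
  apply: le_layers => [x Kx|]; last by [].
  by rewrite f0//= (le_trans _ Mj)// -lee_fin fM.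
rewrite (_ : (\int[m]_(x in _) _ = e'%:E * m K)%E); last by rewrite integral_cst.
rewrite riesz_measureK -EFinM lee_fin.
by rewrite /e' mulrAC ler_pdivrMr ?ltr_pwDr// ler_wpM2l ?ltW// ltrDl.
Qed.

(** So far only one inequality, for nonnegative functions. Adding the constant [M] extends it to all
    of [C(K)], because [m K = ell 1] is an equality; applying it to [- f] reverses it. *)
Lemma riesz_integral (f : 'rV[R]_d -> R) : C f ->
  (\int[m]_(x in (K : set (BorelRd R d))) (f x)%:E = (ell f)%:E)%E.
Proof.
move=> cf; have cNf : C (fun x => - f x) by move=> x; apply: cvgN; exact: cf.
have [M M0 fM] := within_continuous_bounded cK cf.
have mKoo : (m K < +oo)%E by rewrite riesz_measureK ltry.
have bnd (g : 'rV[R]_d -> R) : C g -> (forall x, K x -> `|g x| <= M) ->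
    m.-integrable (K : set (BorelRd R d)) (fun x => (g x)%:E) /\
    (\int[m]_(x in (K : set (BorelRd R d))) (g x)%:E <= (ell g)%:E)%E.
  move=> cg gM.
  have ig : m.-integrable (K : set (BorelRd R d)) (fun x => (g x)%:E).
    apply: (measurable_bounded_integrable (f := g : BorelRd R d -> R)) => //.
    - by apply/measurable_EFinP; exact: measurable_C.
    - exists M; split; first exact: num_real.
      by move=> y /ltW My x /gM/le_trans; apply.
  split => //.
  have icst : m.-integrable (K : set (BorelRd R d)) (cst M%:E).
    apply: (measurable_bounded_integrable (f := cst M : BorelRd R d -> R)) => //.
    exists `|M|; split; first exact: num_real.
    by move=> y /ltW My x _.
  have := @integral_le_ell (fun x => g x + M * 1).
  have cgM : C (fun x => g x + M * 1) by exact: within_continuous_lin.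
  move=> /(_ cgM); rewrite ell_lin//.
  under eq_integral do rewrite mulr1 EFinD.
  rewrite integralD// (_ : (\int[m]_(x in _) M%:E = M%:E * m K)%E); last by rewrite integral_cst.
  rewrite riesz_measureK -EFinM EFinD leeD2rE//; apply => x Kx.
  by have := gM x Kx; rewrite ler_norml mulr1 => /andP[]; lra.
have [if_ lef] := bnd f cf fM.
have [|_] := bnd (fun x => - f x) cNf; first by move=> x /fM; rewrite normrN.
under eq_integral do rewrite EFinN.
rewrite integralN; last by apply: integrable_add_def.
have -> : ell (fun x => - f x) = - ell f.
  by rewrite -mulN1r -ellZ//; congr ell; apply/funext => x; rewrite mulN1r.
by rewrite EFinN leeN2 => gef; apply/eqP; rewrite eq_le lef gef.
Qed.

Theorem riesz_representation :
  exists nu : {measure set (BorelRd R d) -> \bar R},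
    [/\ (nu setT < +oo)%E, nu (~` K) = 0%E &
      forall f : 'rV[R]_d -> R, C f ->
        (\int[nu]_(x in (K : set (BorelRd R d))) (f x)%:E = (ell f)%:E)%E].
Proof.
exists m; split; last exact: riesz_integral.
  by rewrite ltey_eq mu_fin.
apply/eqP; rewrite eq_le mu_ge0 andbT; apply: mu_le; rewrite -ell0.
by apply: cover1 => //; exact: within_continuous_cst.
Qed.

End Riesz.

(** * Integrals of functions bounded above *)

Lemma limn_esup_bounded {R : realType} (u : nat -> \bar R) (a : \bar R) N :
  (forall n, (N <= n)%N -> (u n <= a)%E) -> (limn_esup u <= a)%E.
Proof.
move=> ua; apply: ge_ereal_inf; exists (ereal_sup (u @` [set n | (N <= n)%N])).
  by exists [set n | (N <= n)%N] => //; exists N.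
by apply: ge_ereal_sup => _ [n /= Nn <-]; exact: ua.
Qed.

Lemma limn_einf_bounded {R : realType} (u : nat -> \bar R) (a : \bar R) :
  (forall n, (u n <= a)%E) -> (limn_einf u <= a)%E.
Proof. by move=> ua; apply: le_trans (limn_einf_sup _) (limn_esup_bounded (N := 0) _). Qed.

Section IntegralsBoundedAbove.
Context {dT : measure_display} {T : measurableType dT} {R : realType}
  (mu : {measure set T -> \bar R}) (D : set T) (mD : measurable D).
Local Open Scope ereal_scope.
Implicit Types f g : T -> \bar R.

(** Positive and negative parts are compared separately, so that functions with integral [-oo] are
    covered. *)
Lemma le_integral_measurable f g : measurable_fun D f -> measurable_fun D g ->
  (forall x, D x -> f x <= g x) -> \int[mu]_(x in D) f x <= \int[mu]_(x in D) g x.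
Proof.
move=> mf mg fg; rewrite (integralE _ _ f) (integralE _ _ g); apply: leeB.
  apply: ge0_le_integral => //; [exact: measurable_funepos|exact: measurable_funepos|].
  by move=> x Dx; apply: (@funepos_le _ _ D) => [y /[!inE]|]; [exact: fg|rewrite inE].
apply: ge0_le_integral => //; [exact: measurable_funeneg|exact: measurable_funeneg|].
by move=> x Dx; apply: (@funeneg_le _ _ D) => [y /[!inE]|]; [exact: fg|rewrite inE].
Qed.

Hypothesis muD : mu D < +oo.

Lemma integral_le_cst f (M : R) : measurable_fun D f ->
  (forall x, D x -> f x <= M%:E) -> \int[mu]_(x in D) f x <= M%:E * mu D.
Proof.
move=> mf fM; rewrite -integral_cst//.
by apply: le_integral_measurable => //; exact: measurable_cst.
Qed.

Lemma integral_le_cst_ae f (M : R) : measurable_fun D f ->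
  {ae mu, forall x, D x -> f x <= M%:E} -> \int[mu]_(x in D) f x <= M%:E * mu D.
Proof.
move=> mf fM; have mm : measurable_fun D (fun x => mine (f x) M%:E).
  by apply: measurable_mine => //; exact: measurable_cst.
rewrite (@ae_eq_integral _ _ _ _ _ (fun x => mine (f x) M%:E))//.
  by apply: integral_le_cst => // x _; rewrite ge_min lexx orbT.
by apply: filterS fM => x fx Dx; apply/esym/min_idPl; exact: fx.
Qed.

Lemma integral_bounded_above_lty f (M : R) : measurable_fun D f ->
  (forall x, D x -> f x <= M%:E) -> \int[mu]_(x in D) f x < +oo.
Proof.
move=> mf fM; apply: le_lt_trans (integral_le_cst mf fM) _.
by rewrite ltey_eq fin_numM// ge0_fin_numE.
Qed.

Lemma integrable_bounded_above f (M : R) : measurable_fun D f ->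
  (forall x, D x -> f x <= M%:E) -> \int[mu]_(x in D) f x != -oo ->
  mu.-integrable D f.
Proof.
move=> mf fM fNoo; apply/integrableP; split => //.
have mp : measurable_fun D f^\+ by exact: measurable_funepos.
have mn : measurable_fun D f^\- by exact: measurable_funeneg.
have pfin : \int[mu]_(x in D) f^\+ x < +oo.
  apply: (integral_bounded_above_lty (f := f^\+) (M := Num.max M 0%R) mp) => x Dx.
  by rewrite funeposE ge_max EFin_max le_max fM//= le_max lexx orbT.
have nfin : \int[mu]_(x in D) f^\- x < +oo.
  rewrite ltey; apply: contra fNoo => /eqP nE; rewrite integralE nE.
  have := integral_ge0 mu (fun x (_ : D x) => funepos_ge0 f x).
  by case: (\int[mu]_(x in D) f^\+ x) pfin.
rewrite (_ : (fun x => _) = fun x => f^\+ x + f^\- x); last first.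
  by rewrite -[LHS]/(abse \o f) fune_abse.
by rewrite ge0_integralD// lte_add_pinfty.
Qed.

(** Fatou's lemma for [M - f n >= 0]. The common lower bound [c] makes every [f n] integrable, which
    allows the constant to be split off. *)
Lemma reverse_fatou (f : nat -> T -> \bar R) (M c : R) :
  (forall n, measurable_fun D (f n)) ->
  (forall n x, D x -> f n x <= M%:E) ->
  (forall n, c%:E <= \int[mu]_(x in D) f n x) ->
  c%:E <= \int[mu]_(x in D) limn_esup (f ^~ x).
Proof.
move=> mf fM cf.
have iM : mu.-integrable D (cst M%:E).
  apply/integrableP; split; first exact: measurable_cst.
  rewrite (_ : \int[mu]_(x in D) _ = `|M%:E| * mu D); last by rewrite -integral_cst.
  by rewrite ltey_eq fin_numM// ge0_fin_numE.
have if_ n : mu.-integrable D (f n).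
  apply: (integrable_bounded_above (mf n) (fM n)).
  by rewrite -ltNye (lt_le_trans _ (cf n))// ltNyr.
pose F x := limn_esup (f ^~ x).
have mF : measurable_fun D F by exact: measurable_fun_limn_esup.
pose G x := M%:E - F x.
have GE x : limn_einf (fun n => M%:E - f n x) = G x.
  by rewrite limn_einf_shift// limn_einfN.
have : \int[mu]_(x in D) G x <= (M%:E * mu D - c%:E).
  under eq_integral do rewrite -GE.
  apply: le_trans (fatou mu mD _ _) _.
  - by move=> n; apply: emeasurable_funB => //; exact: measurable_cst.
  - by move=> n x Dx; rewrite sube_ge0 ?fM//= ?orbT.
  apply: limn_einf_bounded => n.
  rewrite integralB//.
  by rewrite integral_cst//; apply: leeB.
move=> GleM.
have mG : measurable_fun D G by apply: emeasurable_funB => //; exact: measurable_cst.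
have FM x : D x -> F x <= M%:E by move=> Dx; apply: (limn_esup_bounded (N := 0)) => n _; exact: fM.
have iG : mu.-integrable D G.
  apply/integrableP; split => //.
  rewrite (@eq_integral _ _ _ _ _ G); last first.
    by move=> x /[!inE] Dx; rewrite gee0_abs// sube_ge0 ?FM//= ?orbT.
  apply: le_lt_trans GleM _.
  by rewrite ltey_eq fin_numB fin_numM// ge0_fin_numE.
(* The identity [F = M - (M - F)] persists at [F = -oo], and [G] is integrable, so the integral can
   be split once more. *)
have -> : \int[mu]_(x in D) F x = \int[mu]_(x in D) (cst M%:E x - G x).
  apply: eq_integral => x /[!inE] Dx; rewrite /G /=.
  by have := FM x Dx; case: (F x) => //= y _; congr EFin; rewrite opprB addrC subrK.
rewrite integralB// integral_cst//.
have [m mE] : exists m : R, mu D = m%:E.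
  by exists (fine (mu D)); rewrite fineK// ge0_fin_numE.
move: GleM; rewrite mE -EFinM -EFinB.
have : \int[mu]_(x in D) G x \is a fin_num by exact: integrable_fin_num.
by case: (\int[mu]_(x in D) G x) => //= y _; rewrite !lee_fin => ?; lra.
Qed.

End IntegralsBoundedAbove.

(** * Euclidean balls and their volumes *)

Section EuclideanBalls.
Context {R : realType} {d : nat}.
Implicit Types (x y : 'rV[R]_d) (t : R).

Lemma enorm_ge0 x : 0 <= enorm x.
Proof. exact: sqrtr_ge0. Qed.

Lemma enorm_sqr x : enorm x ^+ 2 = \sum_(i < d) x ord0 i ^+ 2.
Proof. by rewrite sqr_sqrtr// sumr_ge0// => i _; exact: sqr_ge0. Qed.

(** The vector [|y|^2 x - S y] is [|y|^2] times the component of [x] orthogonal to [y]; the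
    inequality is the nonnegativity of its squared norm. *)
Lemma cauchy_schwarz x y :
  \sum_(i < d) x ord0 i * y ord0 i <= enorm x * enorm y.
Proof.
set S := \sum_(i < d) _.
have [B0|B0] := eqVneq (enorm y) 0.
  rewrite B0 mulr0 /S big1// => i _.
  have : \sum_(i < d) y ord0 i ^+ 2 == 0 by rewrite -enorm_sqr B0 expr0n.
  rewrite psumr_eq0 => [|j _]; last exact: sqr_ge0.
  by move=> /allP/(_ i (mem_index_enum i)); rewrite /= sqrf_eq0 => /eqP ->; rewrite mulr0.
have Bpos : 0 < enorm y by rewrite lt_neqAle eq_sym B0 enorm_ge0.
have : 0 <= \sum_(i < d) (enorm y ^+ 2 * x ord0 i - S * y ord0 i) ^+ 2.
  by apply: sumr_ge0 => i _; exact: sqr_ge0.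
have -> : \sum_(i < d) (enorm y ^+ 2 * x ord0 i - S * y ord0 i) ^+ 2 =
    enorm y ^+ 2 * ((enorm x * enorm y) ^+ 2 - S ^+ 2).
  rewrite (eq_bigr (fun i => (enorm y ^+ 2) ^+ 2 * x ord0 i ^+ 2
    + (- (2 * enorm y ^+ 2 * S)) * (x ord0 i * y ord0 i) + S ^+ 2 * y ord0 i ^+ 2)); last first.
    by move=> i _; ring.
  rewrite !big_split/= -!mulr_sumr -!enorm_sqr -/S; ring.
rewrite pmulr_rge0 ?exprn_gt0// subr_ge0 => S2.
have [S0|S0] := leP S 0; first by rewrite (le_trans S0)// mulr_ge0// enorm_ge0.
by rewrite -(@ler_pXn2r _ 2)// nnegrE ?mulr_ge0 ?enorm_ge0// ltW.
Qed.

Lemma enormD x y : enorm (x + y) <= enorm x + enorm y.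
Proof.
rewrite -(@ler_pXn2r _ 2)// ?nnegrE ?addr_ge0 ?enorm_ge0//.
rewrite enorm_sqr sqrrD !enorm_sqr.
under eq_bigr do rewrite mxE sqrrD.
rewrite !big_split/= lerD2r lerD2l mulr2n.
by apply: lerD; exact: cauchy_schwarz.
Qed.

Lemma enorm_distC x y : enorm (x - y) = enorm (y - x).
Proof.
congr Num.sqrt; apply: eq_bigr => i _.
by rewrite !mxE -sqrrN opprB.
Qed.

Lemma ler_coord_norm x i : `|x ord0 i| <= `|x|.
Proof.
by rewrite [leRHS]/Num.norm/= mx_normrE; apply/bigmax_geP; right; exists (ord0, i).
Qed.

Lemma ler_coord_enorm x i : `|x ord0 i| <= enorm x.
Proof.
rewrite -(@ler_pXn2r _ 2)// ?nnegrE ?enorm_ge0// enorm_sqr real_normK ?num_real//.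
by rewrite (bigD1 i)//= ler_wpDr// sumr_ge0// => j _; exact: sqr_ge0.
Qed.

Lemma ler_norm_enorm x : `|x| <= enorm x.
Proof.
rewrite [leLHS]/Num.norm/= mx_normrE; apply/bigmax_leP; split; first exact: enorm_ge0.
by move=> [i j] _ /=; rewrite (ord1 i); exact: ler_coord_enorm.
Qed.

(** The crude factor [d] in place of [sqrt d] suffices to compare topologies and volumes. *)
Lemma enorm_le_coord x t : 0 <= t -> (forall i, `|x ord0 i| <= t) -> enorm x <= d%:R * t.
Proof.
move=> t0 xt; rewrite -(@ler_pXn2r _ 2)// ?nnegrE ?mulr_ge0 ?enorm_ge0// enorm_sqr.
apply: (@le_trans _ _ (\sum_(i < d) t ^+ 2)).
  apply: ler_sum => i _; rewrite -real_normK ?num_real//.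
  by rewrite ler_pXn2r// nnegrE.
rewrite sumr_const card_ord exprMn -[leLHS]mulr_natl ler_wpM2r ?sqr_ge0//.
by rewrite -natrX ler_nat; case: (d) => // n; rewrite expnS expn1 leq_pmulr.
Qed.

Lemma enorm_le_norm x : enorm x <= d%:R * `|x|.
Proof. by apply: enorm_le_coord => // i; exact: ler_coord_norm. Qed.

Lemma enorm0 : enorm (0 : 'rV[R]_d) = 0.
Proof. by rewrite /enorm big1 ?sqrtr0// => i _; rewrite mxE expr0n. Qed.

Lemma cball_refl x t : 0 <= t -> cball x t x.
Proof. by rewrite /cball/= subrr enorm0. Qed.

Lemma subset_cball x y s t : enorm (x - y) + s <= t -> cball x s `<=` cball y t.
Proof.
move=> st z /= zx; rewrite /cball/= -[z - y](subrKA x) (le_trans (enormD _ _))//.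
by rewrite (le_trans _ st)// addrC lerD2l.
Qed.

Lemma nbhs_cball x t : 0 < t -> nbhs x (cball x t).
Proof.
(* [d.+1] in place of [d], since [d] may be [0] here. *)
move=> t0; have dt : 0 < t / d.+1%:R by rewrite divr_gt0.
apply/nbhs_ballP; exists (t / d.+1%:R) => //= y; rewrite -ball_normE/= => xy.
rewrite /cball/= (le_trans (enorm_le_norm _))// distrC.
apply: (@le_trans _ _ (d%:R * (t / d.+1%:R))).
  by rewrite ler_wpM2l// ltW.
rewrite mulrA ler_pdivrMr ?ltr0n// mulrC ler_wpM2l ?(ltW t0)//.
by rewrite ler_nat.
Qed.

Lemma cball_sub_nbhs x (A : set 'rV[R]_d) : nbhs x A -> exists2 t, 0 < t & cball x t `<=` A.
Proof.
move=> /nbhs_ballP[e /= e0 eA]; exists (e / 2); first by rewrite divr_gt0.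
move=> y /= yx; apply: eA; rewrite -ball_normE/= distrC.
by rewrite (le_lt_trans (ler_norm_enorm _))// (le_lt_trans yx)// ltr_pdivrMr// ltr_pMr// ltr1n.
Qed.

Lemma enorm_continuous y : continuous (fun x => enorm (x - y)).
Proof.
apply: (@lipschitz_continuous _ _ _ d%:R) => // x z.
rewrite -[x - y](subrKA z) addrC (le_trans (enormD _ _))// lerD2l.
exact: enorm_le_norm.
Qed.

Lemma cball_closed x t : closed (cball x t).
Proof.
have -> : cball x t = (fun y => enorm (y - x)) @^-1` [set s | s <= t] by [].
by apply: preimage_closed; [move=> y _; exact: enorm_continuous|exact: closed_le].
Qed.

Lemma bounded_by_norm_set (A : set 'rV[R]_d) t : (forall x, A x -> `|x| <= t) -> bounded_set A.
Proof.
move=> At; exists t; split; first exact: num_real.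
by move=> s /ltW ts x /At/le_trans; apply.
Qed.

Lemma cball_compact x t : compact (cball x t).
Proof.
apply: bounded_closed_compact; last exact: cball_closed.
apply: (@bounded_by_norm_set _ (t + `|x|)) => y /= yx.
rewrite -[y](subrK x) (le_trans (ler_normD _ _))// lerD2r.
exact: le_trans (ler_norm_enorm _) yx.
Qed.

Lemma cball_measurable x t : measurable (cball x t : set (BorelRd R d)).
Proof. by apply: closed_measurable_Rd; exact: cball_closed. Qed.

Section BallVolumes.
Variable lam : {measure set (BorelRd R d) -> \bar R}.
Hypotheses (lam_leb : is_lebesgue_measure lam) (d0 : (0 < d)%N).

Let box (x : 'rV[R]_d) (t : R) : set (BorelRd R d) :=
  [set y | forall i, (x - const_mx t) ord0 i <= y ord0 i <= (x + const_mx t) ord0 i].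

Let boxP x t (y : 'rV[R]_d) : box x t y <-> forall i, `|(y - x) ord0 i| <= t.
Proof.
by split=> H i; have := H i; rewrite !mxE ler_norml => /andP[? ?]; apply/andP; split; lra.
Qed.

Let closed_box x t : closed (box x t : set 'rV[R]_d).
Proof.
rewrite (_ : box x t = \bigcap_(i in [set: 'I_d])
    ((fun y : 'rV[R]_d => y ord0 i) @^-1` `[(x - const_mx t) ord0 i, (x + const_mx t) ord0 i]%classic)).
  apply: closed_bigI => i _; apply: preimage_closed => [y _|]; last exact: interval_closed.
  exact: coord_continuous.
apply/seteqP; split => y /=; first by move=> yb i _ /=; rewrite in_itv; exact: yb.
by move=> yb i; have := yb i I; rewrite /= in_itv.
Qed.

Let lam_box x t : 0 <= t -> lam (box x t) = ((2 * t) ^+ d)%:E.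
Proof.
move=> t0; rewrite /box lam_leb => [|i]; last by rewrite !mxE; lra.
congr EFin; rewrite (eq_bigr (fun=> 2 * t)); last by move=> i _; rewrite !mxE; ring.
by rewrite prodr_const card_ord.
Qed.

Lemma lam_cball_le x t : 0 <= t -> (lam (cball x t) <= ((2 * t) ^+ d)%:E)%E.
Proof.
move=> t0; rewrite -(lam_box x t0); apply: le_measure; rewrite ?inE.
- exact: cball_measurable.
- by apply: closed_measurable_Rd; exact: closed_box.
- by move=> y yx; apply/boxP => i; rewrite (le_trans (ler_coord_enorm _ _)).
Qed.

Lemma lam_cball_ge x t : 0 <= t -> (((2 * (t / d%:R)) ^+ d)%:E <= lam (cball x t))%E.
Proof.
move=> t0; have td0 : 0 <= t / d%:R by rewrite divr_ge0.
rewrite -(lam_box x td0); apply: le_measure; rewrite ?inE.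
- by apply: closed_measurable_Rd; exact: closed_box.
- exact: cball_measurable.
- move=> y /boxP /(enorm_le_coord td0)/le_trans; apply.
  by rewrite mulrCA mulfV ?mulr1// pnatr_eq0 -lt0n.
Qed.

Lemma lam_cball_fin x t : lam (cball x t) \is a fin_num.
Proof.
rewrite ge0_fin_numE//; have [t0|t0] := leP 0 t.
  by rewrite (le_lt_trans (lam_cball_le x t0))// ltry.
rewrite (_ : cball x t = set0) ?measure0//; rewrite -subset0 => y /= yt.
by have := lt_le_trans t0 (enorm_ge0 (y - x)); rewrite ltNge yt.
Qed.

Lemma lam_cball_lty x t : (lam (cball x t) < +oo)%E.
Proof. by rewrite ltey_eq lam_cball_fin. Qed.

Definition vol x t : R := fine (lam (cball x t)).

Lemma volE x t : (vol x t)%:E = lam (cball x t).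
Proof. by rewrite fineK// lam_cball_fin. Qed.

Lemma vol_gt0 x t : 0 < t -> 0 < vol x t.
Proof.
move=> t0; rewrite -lte_fin volE; apply: lt_le_trans (lam_cball_ge x (ltW t0)).
by rewrite lte_fin exprn_gt0// mulr_gt0// divr_gt0// ltr0n.
Qed.

(** [lam] is given by its values on boxes: a ball of radius [2 t] lies in a cube of volume
    [(4 t)^d], a ball of radius [t] contains one of volume [(2 t / d)^d], and the quotient is the
    constant. The two centres are unrelated. *)
Lemma vol_doubling : exists2 C : R, 0 < C &
  forall x y t, 0 < t -> vol x (2 * t) <= C * vol y t.
Proof.
exists ((2 * d%:R) ^+ d); first by rewrite exprn_gt0// mulr_gt0// ltr0n.
move=> x y t t0; have t20 : 0 <= 2 * t by rewrite mulr_ge0// ltW.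
rewrite -lee_fin EFinM !volE; apply: le_trans (lam_cball_le x t20) _.
apply: (@le_trans _ _ (((2 * d%:R) ^+ d)%:E * ((2 * (t / d%:R)) ^+ d)%:E)%E).
  rewrite -EFinM -exprMn lee_fin (_ : 2 * d%:R * _ = 2 * (2 * t))//.
  by field; rewrite pnatr_eq0 -lt0n.
by rewrite lee_wpmul2l// ?lee_fin ?exprn_ge0 ?mulr_ge0//; exact/lam_cball_ge/ltW.
Qed.

End BallVolumes.
End EuclideanBalls.

(** Finite subcovers as an induction principle, later applied to integrability. Near-covering is
    used with the filter of those families of sets that contain every sufficiently large member of
    [Q]. *)
Lemma compact_induction {T : topologicalType} (K : set T) (Q : set T -> Prop) :
  compact K -> Q set0 -> (forall A B, Q A -> Q B -> Q (A `|` B)) ->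
  (forall x, K x -> exists2 U, nbhs x U & Q U) -> exists2 A, Q A & K `<=` A.
Proof.
move=> /compact_near_coveringP cK Q0 QU KQ.
pose F : set_system (set T) :=
  [set S | exists2 A, Q A & forall B, Q B -> A `<=` B -> S B].
have FF : Filter F.
  split.
  - by exists set0.
  - move=> S S' [A QA AS] [B QB BS]; exists (A `|` B); first exact: QU.
    move=> X QX ABX; split; [apply: AS => //|apply: BS => //].
      by move=> x Ax; apply: ABX; left.
    by move=> x Bx; apply: ABX; right.
  - by move=> S S' SS' [A QA AS]; exists A => // B QB AB; apply/SS'/AS.
have [|A QA /(_ A QA)] := cK _ F (fun B x => B x) FF; last first.
  by move=> /(_ (@subset_refl _ A)); exists A.
move=> x /KQ[U xU QUx]; exists (U, [set B | U `<=` B]); last by move=> [y B] [/= Uy]; exact.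
by split => //; exists U.
Qed.

Lemma integrable_setU {dT : measure_display} {T : measurableType dT} {R : realType}
    (mu : {measure set T -> \bar R}) (A B : set T) (f : T -> \bar R) :
  measurable A -> measurable B -> mu.-integrable A f -> mu.-integrable B f ->
  mu.-integrable (A `|` B) f.
Proof.
move=> mA mB /integrableP[mfA fA] iB.
have mBA : measurable (B `\` A) by exact: measurableD.
have /integrableP[mfBA fBA] : mu.-integrable (B `\` A) f.
  by apply: integrableS iB => //; exact: subDsetl.
rewrite (_ : A `|` B = A `|` (B `\` A)); last first.
  apply/seteqP; split => x; last by case=> [|[]]; [left|right].
  by move=> [Ax|Bx]; [left|have [Ax|nAx] := pselect (A x); [left|right]].
have mf : measurable_fun (A `|` B `\` A) f by apply/measurable_funU.
apply/integrableP; split => //.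
rewrite ge0_integral_setU//; first exact: lte_add_pinfty.
  exact: measurableT_comp.
by apply/disj_setPS => x [Ax []].
Qed.

Lemma le_of_lt_real {R : realType} (x y : \bar R) :
  (forall a : R, (y < a%:E)%E -> (x <= a%:E)%E) -> (x <= y)%E.
Proof.
case: y => [y| |] xy.
- by apply/lee_addgt0Pr => e e0; rewrite -EFinD; apply: xy; rewrite lte_fin ltrDl.
- exact: leey.
- case: x xy => [x| |] // xy.
    by have := xy (x - 1) (ltNyr _); rewrite lee_fin lerDl oppr_ge0 ler10.
  by have := xy 0 (ltNyr _).
Qed.

(** * Subharmonic functions on a domain *)

Section Subharmonic.
Context {R : realType} {d : nat} (d0 : (0 < d)%N).
Variables (lam : {measure set (BorelRd R d) -> \bar R}) (lam_leb : is_lebesgue_measure lam).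
Variables (D : set 'rV[R]_d) (D_dom : is_domain D).
Implicit Types (u v w : 'rV[R]_d -> \bar R) (K : set 'rV[R]_d).
Local Notation sh := (subharmonic lam D).
Local Notation "\intB_ ( x , t ) u" :=
  (\int[lam]_(y in (cball x t : set (BorelRd R d))) u y)%E
  (at level 36, x, t at level 200, u at level 36).

Let Dopen : open D. Proof. by case: D_dom. Qed.

Lemma domain_cball x : D x -> exists2 t, 0 < t & cball x t `<=` D.
Proof. by move=> Dx; apply: cball_sub_nbhs; exact: open_nbhs_nbhs. Qed.

Lemma subharmonic_mean u x t : sh u -> 0 < t -> cball x t `<=` D ->
  ((vol lam x t)%:E * u x <= \intB_(x, t) u)%E.
Proof.
move=> [_ _ um] t0 xD; rewrite -lee_pdivlMl; first exact: um.
exact: (vol_gt0 lam_leb d0).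
Qed.

Lemma subharmonic_usc_within u K : sh u -> K `<=` D -> usc_within K u.
Proof. by move=> [_ /usc_onW uu _] KD; exact: usc_withinS uu. Qed.

Lemma subharmonic_measurable u K : sh u -> measurable (K : set (BorelRd R d)) ->
  K `<=` D -> measurable_fun (K : set (BorelRd R d)) u.
Proof.
by move=> su mK KD; apply: usc_within_measurable => //; exact: subharmonic_usc_within.
Qed.

Lemma subharmonic_bounded u K : sh u -> compact K -> K `<=` D ->
  exists2 M : R, 0 <= M & forall x, K x -> (u x <= M%:E)%E.
Proof.
move=> su cK KD; apply: usc_compact_bounded => //.
  exact: subharmonic_usc_within.
by move=> x /KD Dx; case: su => + _ _; exact.
Qed.

(** If [w x < a], then [w < a] on a small ball around [x], hence [v <= a] almost everywhere on it,
    and the mean value inequality gives [v x <= a]. *)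
Lemma subharmonic_le_usc v w : sh v -> usc_within D w ->
  {ae lam, forall x : BorelRd R d, D x -> (v x <= w x)%E} ->
  forall x, D x -> (v x <= w x)%E.
Proof.
move=> sv uw vw x Dx; apply: le_of_lt_real => a wa.
have [t t0 xt] : exists2 t, 0 < t & cball x t `<=` [set y | D y /\ (w y < a%:E)%E].
  apply: cball_sub_nbhs; have near_w := uw x Dx a wa.
  have : \forall y \near x, D y by exact: open_nbhs_nbhs.
  by apply: filterS2 near_w => y wy Dy; split => //; exact: wy.
have xtD : cball x t `<=` D by move=> y /xt[].
have := subharmonic_mean sv t0 xtD.
have mv := subharmonic_measurable sv (cball_measurable x t) xtD.
have : (\intB_(x, t) v <= a%:E * lam (cball x t))%E.
  apply: integral_le_cst_ae => //; first exact: cball_measurable.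
  apply: filterS vw => y vwy xy; have [Dy wy] := xt y xy.
  by rewrite (le_trans (vwy Dy))// ltW.
move=> /[swap]/le_trans/[apply].
by rewrite -(volE lam_leb) muleC lee_pmul2r// ?lte_fin ?(vol_gt0 lam_leb d0).
Qed.

Lemma subharmonic_integrable_cball u x t : sh u -> cball x t `<=` D ->
  \intB_(x, t) u != -oo%E -> lam.-integrable (cball x t : set (BorelRd R d)) u.
Proof.
move=> su xD; have [M _ uM] := subharmonic_bounded su (@cball_compact _ _ x t) xD.
apply: (@integrable_bounded_above _ (BorelRd R d) R lam (cball x t)
  (cball_measurable x t) (lam_cball_lty lam_leb x t) u M) => //.
by apply: subharmonic_measurable => //; exact: cball_measurable.
Qed.

Let integrable_sub_cball u x y s t : sh u -> cball y t `<=` D ->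
  cball x s `<=` cball y t -> \intB_(y, t) u != -oo%E -> \intB_(x, s) u != -oo%E.
Proof.
move=> su yD xy /(subharmonic_integrable_cball su yD) iu.
have /integrable_fin_num : lam.-integrable (cball x s : set (BorelRd R d)) u.
  by apply: integrableS iu => //; exact: cball_measurable.
by move=> /(_ (cball_measurable x s)); rewrite fin_numE => /andP[].
Qed.

(** A connectedness argument: the set [A] of points with a ball of finite integral contains [z], is
    open, and is closed in [D], because [u] is identically [-oo] near each point of [D] outside
    [A]. *)
Lemma subharmonic_locally_integrable u x : sh u -> not_minfty D u -> D x ->
  exists t, [/\ 0 < t, cball x t `<=` D & \intB_(x, t) u != -oo%E].
Proof.
move=> su [z [Dz uz]].
pose A := [set x | D x /\ exists t, [/\ 0 < t, cball x t `<=` D & \intB_(x, t) u != -oo%E]].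
suff DA : D = A by rewrite {1}DA => -[_].
case: D_dom => _ [Dconn _].
(* If [u y' > -oo] for some [y'] within [t / 4] of [y], the mean value inequality gives a finite
   integral on the ball of radius [t / 2] around [y'], which contains the ball of radius [t / 4]
   around [y]. *)
have notA y : D y -> ~ A y -> \forall y' \near y, D y' /\ u y' = -oo%E.
  move=> Dy nAy; have [t t0 tD] := domain_cball Dy.
  have t20 : 0 < t / 2 by rewrite divr_gt0.
  have t40 : 0 < t / 4 by rewrite divr_gt0.
  apply: filterS (nbhs_cball y t40) => y' yy'.
  have sub : cball y' (t / 2) `<=` D.
    apply: subset_trans tD; apply: subset_cball; rewrite /cball/= in yy'.
    by lra.
  split; first by apply: sub; exact: cball_refl (ltW t20).
  apply/eqP/negPn/negP => uy'; apply: nAy; split => //; exists (t / 4); split => //.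
    apply: subset_trans tD; apply: subset_cball; rewrite subrr enorm0; lra.
  apply: (integrable_sub_cball su sub).
    by apply: subset_cball; rewrite enorm_distC; rewrite /cball/= in yy'; lra.
  have := subharmonic_mean su t20 sub; rewrite -ltNye; apply: lt_le_trans.
  by move: uy' (let: And3 f _ _ := su in f y' (sub _ (cball_refl _ (ltW t20)))); case: (u y') => // s _ _;
    rewrite -EFinM ltNyr.
apply/esym/Dconn.
- exists z; split => //; have [t t0 tD] := domain_cball Dz; exists t; split => //.
  have := subharmonic_mean su t0 tD; rewrite -ltNye; apply: lt_le_trans.
  by move: uz (let: And3 f _ _ := su in f z Dz); case: (u z) => // s _ _; rewrite -EFinM ltNyr.
- exists A; last by apply/seteqP; split => y; [move=> Ay; split => //; case: Ay|case].
  rewrite openE => y [Dy [t [t0 tD ut]]].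
  have t20 : 0 < t / 2 by rewrite divr_gt0.
  apply: filterS (nbhs_cball y t20) => y' yy'.
  have sub : cball y' (t / 2) `<=` cball y t.
    by apply: subset_cball; rewrite /cball/= in yy'; lra.
  split; first by apply/tD/sub/cball_refl/ltW.
  by exists (t / 2); split => //; [exact: subset_trans tD|exact: integrable_sub_cball ut].
- exists (~` (D `\` A)); last first.
    apply/seteqP; split => y; first by move=> Ay; split; [case: Ay|case].
    by move=> [Dy nDA]; apply: contrapT => nAy; exact: nDA.
  apply: open_closedC; rewrite openE => y [Dy nAy].
  have /nbhs_interior := notA y Dy nAy; apply: filterS => y' y'N.
  have [s s0 sN] := cball_sub_nbhs y'N.
  have Dy' : D y' by case: (sN y' (cball_refl y' (ltW s0))).
  split; first exact: Dy'.
  move=> [_ [t [t0 tD ut]]].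
  (* On this common ball [u] would be constantly [-oo] and yet have an integral other than [-oo]. *)
  pose s' := Num.min s t.
  have s'0 : 0 < s' by rewrite lt_min s0 t0.
  have sub1 : cball y' s' `<=` cball y' s.
    by apply: subset_cball; rewrite subrr enorm0 add0r ge_min lexx.
  have sub2 : cball y' s' `<=` cball y' t.
    by apply: subset_cball; rewrite subrr enorm0 add0r ge_min lexx orbT.
  have := integrable_sub_cball su tD sub2 ut => /eqP; apply.
  rewrite (@eq_integral _ _ _ _ _ (cst -oo%E)); last first.
    by move=> w /[!inE] /sub1/sN[].
  rewrite integral_cst; last exact: cball_measurable.
  by rewrite -(volE lam_leb) mulNyr gtr0_sg ?mul1e// (vol_gt0 lam_leb d0).
Qed.

Lemma subharmonic_integrable u K : sh u -> not_minfty D u -> compact K -> K `<=` D ->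
  lam.-integrable (K : set (BorelRd R d)) u.
Proof.
move=> su un cK KD.
pose Q A := measurable (A : set (BorelRd R d)) /\ lam.-integrable (A : set (BorelRd R d)) u.
have [| | |A [mA iA] KA] := @compact_induction _ K Q cK.
- by split; [exact: measurable0|exact: integrable_set0].
- move=> A B [mA iA] [mB iB]; split; [exact: measurableU|exact: integrable_setU].
- move=> x /KD Dx; have [t [t0 tD ut]] := subharmonic_locally_integrable su un Dx.
  exists (cball x t); first exact: nbhs_cball.
  by split; [exact: cball_measurable|exact: subharmonic_integrable_cball].
by apply: integrableS iA => //; exact: compact_measurable_Rd.
Qed.

End Subharmonic.

(** * Approximation from above and exhaustion by compact sets *)

Lemma integral_null_setC {dT : measure_display} {T : measurableType dT} {R : realType}
    (mu : {measure set T -> \bar R}) (D K : set T) (f : T -> \bar R) :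
  measurable D -> measurable K -> K `<=` D -> mu (~` K) = 0%E -> measurable_fun D f ->
  (\int[mu]_(x in D) f x = \int[mu]_(x in K) f x)%E.
Proof.
move=> mD mK KD K0 mf; rewrite integralE [RHS]integralE.
have DK : D `\` ~` K = K by rewrite setDE setCK; apply/setIidr.
have mKC : measurable (~` K) by exact: measurableC.
rewrite (ge0_negligible_integral mKC mD _ _ K0)//; last exact: measurable_funepos.
rewrite DK; congr (_ - _)%E.
by rewrite (ge0_negligible_integral mKC mD _ _ K0)// ?DK//; exact: measurable_funeneg.
Qed.

Lemma addr_lt_real {R : realType} (x a : R) (y : \bar R) : (x%:E + y < a%:E)%E ->
  exists2 e, 0 < e & (y < (a - x - e)%:E)%E.
Proof.
case: y => [s| |]//; last by move=> _; exists 1 => //; exact: ltNyr.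
rewrite -EFinD lte_fin => xs; exists ((a - x - s) / 2); last by rewrite lte_fin; lra.
by rewrite divr_gt0//; lra.
Qed.

Lemma usc_within_addr {R : realType} {d : nat} (A : set 'rV[R]_d) (g : 'rV[R]_d -> R)
    (u : 'rV[R]_d -> \bar R) : {within A, continuous g} -> usc_within A u ->
  usc_within A (fun x => (g x)%:E + u x)%E.
Proof.
move=> /within_continuousP cg uu x Ax a gua.
have [e e0 ue] : exists2 e, 0 < e & (u x < (a - g x - e)%:E)%E.
  exact: addr_lt_real gua.
apply: filterS2 (cg x Ax e e0) (uu x Ax _ ue) => y gy uy Ay.
have := gy Ay; have := uy Ay; case: (u y) => [s| |]// us; last by rewrite addeNy ltNyr.
rewrite ltr_norml => /andP[? ?]; rewrite -EFinD lte_fin.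
by move: us; rewrite lte_fin; lra.
Qed.

(** Supplies the numerical side conditions of [usc_approx], whose last clause thereby becomes a
    statement about all large [n]. *)
Lemma usc_approx_rank {R : realType} (delta a : R) : 0 < delta ->
  exists N : nat, forall n, (N <= n)%N ->
    [/\ 1 <= n%:R * delta, - (n%:R * delta) <= a & - n%:R <= a].
Proof.
move=> delta0; pose q := Num.max (Num.max 1 (- a) / delta) (- a).
exists (Num.truncn q).+1 => n Nn.
have qn : q <= n%:R by rewrite (le_trans (ltW (truncnS_gt q)))// ler_nat.
have : Num.max 1 (- a) / delta <= n%:R by rewrite (le_trans _ qn)// le_max lexx.
rewrite ler_pdivrMr// => /[dup] /(le_trans _) h1 /(le_trans _) h2.
split.
- by apply: h1; rewrite le_max lexx.
- by rewrite lerNl; apply: h2; rewrite le_max lexx orbT.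
- by rewrite lerNl (le_trans _ qn)// le_max lexx orbT.
Qed.

(** The majorants of [usc_approx] are bounded by [M] and their upper limit is at most [u], so the
    lower bound passes to [u] by the reverse Fatou lemma. *)
Lemma usc_integral_ge {R : realType} {d : nat} (nu : {measure set (BorelRd R d) -> \bar R})
    (K : set 'rV[R]_d) (u : 'rV[R]_d -> \bar R) (c : R) :
  compact K -> K !=set0 -> (nu K < +oo)%E -> usc_within K u ->
  (forall x, K x -> (u x < +oo)%E) ->
  (forall phi : 'rV[R]_d -> R, continuous phi -> (forall x, K x -> (u x <= (phi x)%:E)%E) ->
    (c%:E <= \int[nu]_(x in (K : set (BorelRd R d))) (phi x)%:E)%E) ->
  (c%:E <= \int[nu]_(x in (K : set (BorelRd R d))) u x)%E.
Proof.
move=> cK K0 nuK uK uoo cphi; have mK := compact_measurable_Rd cK.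
have [M M0 uM] := usc_compact_bounded cK uK uoo.
(* Ranks start at [1]: the bound [phi n <= M] uses [delta = 1], which requires a rank of at least
   [1]. *)
have /choice[phi phiP] := fun n : nat => usc_approx n.+1 cK K0 uK uoo.
have mphi n : measurable_fun (K : set (BorelRd R d)) (fun x => (phi n x)%:E).
  apply: usc_within_measurable => //; apply: within_continuous_usc.
  by apply: continuous_subspaceT; case: (phiP n).
have phiM n x : K x -> ((phi n x)%:E <= M%:E)%E.
  move=> Kx; rewrite lee_fin; have [_ _ phia] := phiP n; apply: (phia x 1).
  - by rewrite mulr1 ler1n.
  - by rewrite mulr1 (@le_trans _ _ 0)// oppr_le0.
  - by rewrite (@le_trans _ _ 0)// oppr_le0.
  - by move=> y Ky _; exact: uM.
have := @reverse_fatou _ (BorelRd R d) R nu K mK nuK (fun n x => (phi n x)%:E) M c mphi phiM.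
move=> /(_ _)/le_trans le_c; apply: le_c.
  by move=> n; apply: cphi; case: (phiP n).
apply: le_integral_measurable => //.
- exact: measurable_fun_limn_esup.
- exact: usc_within_measurable.
move=> x Kx; apply: le_of_lt_real => a ua.
have /nbhs_ballP[e /= e0 eK] := uK x Kx a ua.
have [N NP] := usc_approx_rank a e0.
apply: (limn_esup_bounded (N := N)) => n Nn; rewrite lee_fin.
have [? ? ?] := NP n.+1 (leqW Nn); have [_ _ phia] := phiP n.
apply: (phia x e) => // y Ky xy; apply/ltW/eK => //.
by rewrite -ball_normE.
Qed.

(** [E n] collects the points of norm at most [n] at distance at least [1 / (n + 1)] from the
    complement of [D]; written as an intersection, this covers an empty complement. The rank is
    uniform near each point, as the locally uniform estimates require. *)
Lemma compact_exhaustion {R : realType} {d : nat} (D : set 'rV[R]_d) : open D ->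
  exists E : nat -> set 'rV[R]_d, [/\ (forall n, compact (E n)),
    (forall n, E n `<=` D) &
    forall x, D x -> exists N, \forall y \near x, forall n, (N <= n)%N -> E n y].
Proof.
move=> Dopen.
pose E (n : nat) := [set x : 'rV[R]_d | `|x| <= n%:R] `&`
  \bigcap_(y in ~` D) [set x : 'rV[R]_d | n.+1%:R^-1 <= `|x - y|].
have cnorm (y : 'rV[R]_d) : continuous (fun x : 'rV[R]_d => `|x - y|).
  apply: (@lipschitz_continuous _ _ _ 1) => // x z; rewrite mul1r [leRHS]addrC.
  exact: ler_distD.
exists E; split.
- move=> n; apply: bounded_closed_compact.
    by apply: (@bounded_by_norm_set _ _ _ n%:R) => x [].
  apply: closedI.
    rewrite (_ : [set x : 'rV[R]_d | `|x| <= n%:R] = (fun x : 'rV[R]_d => `|x - 0|) @^-1` [set s | s <= n%:R]); last first.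
      by apply/seteqP; split => x /=; rewrite subr0.
    by apply: preimage_closed; [move=> x _; exact: cnorm|exact: closed_le].
  apply: closed_bigI => y _.
  rewrite -[X in closed X]/((fun x : 'rV[R]_d => `|x - y|) @^-1` [set s | n.+1%:R^-1 <= s]).
  by apply: preimage_closed; [move=> x _; exact: cnorm|exact: closed_ge].
- move=> n x [_ xE]; apply: contrapT => nDx.
  by have := xE x nDx; rewrite /= subrr normr0 leNgt invr_gt0 ltr0n.
- move=> x Dx; have /nbhs_ballP[e /= e0 eD] : nbhs x D by exact: open_nbhs_nbhs.
  have e20 : 0 < e / 2 by rewrite divr_gt0.
  pose q := Num.max (e / 2)^-1 (`|x| + e / 2).
  exists (Num.truncn q).+1.
  apply/nbhs_ballP; exists (e / 2) => //= y; rewrite -ball_normE/= => xy n Nn.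
  have qn : q <= n%:R by rewrite (le_trans (ltW (truncnS_gt q)))// ler_nat.
  split => [|z nDz] /=.
    rewrite (@le_trans _ _ q)//; apply: (@le_trans _ _ (`|x| + e / 2)); last by rewrite le_max lexx orbT.
    by rewrite -[y](subrK x) addrC (le_trans (ler_normD _ _))// lerD2l distrC ltW.
  have xz : e <= `|x - z|.
    by rewrite leNgt; apply/negP => xz; apply: nDz; apply: eD; rewrite -ball_normE.
  have ne : n.+1%:R^-1 <= e / 2.
    rewrite -[leRHS]invrK lef_pV2 ?posrE ?invr_gt0 ?ltr0n//.
    rewrite (@le_trans _ _ q)// ?le_max ?lexx// (le_trans qn)// ler_nat//.
  by move: ne (ler_distD y x z); move: (n.+1%:R^-1) => s; lra.
Qed.

(** * Setting of the duality and the upper bound *)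

Section Duality.
Context {R : realType} {d : nat} (d0 : (0 < d)%N).
Variables (lam : {measure set (BorelRd R d) -> \bar R}) (lam_leb : is_lebesgue_measure lam).
Variables (D : set 'rV[R]_d) (D_dom : is_domain D).
Variables (o : 'rV[R]_d) (r : R) (r_gt0 : 0 < r) (BD : cball o r `<=` D).
Variables (H : set ('rV[R]_d -> \bar R)) (H_cone : good_cone lam D H).
Variables (g : 'rV[R]_d -> R) (g_cont : forall x, D x -> {for x, continuous g}).
Variables (h1 h2 : 'rV[R]_d -> \bar R) (h1H : H h1) (h2H : H h2).
Hypotheses (h1_ninf : not_minfty D h1) (h2_ninf : not_minfty D h2).
Implicit Types (h u : 'rV[R]_d -> \bar R) (K : set 'rV[R]_d).

Local Notation B := (cball o r).
Local Notation intB h := (\int[lam]_(x in (B : set (BorelRd R d))) h x)%E.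
Local Notation J := (JH lam D H o r).

Let Dopen : open D. Proof. by case: D_dom. Qed.
Let mD : measurable (D : set (BorelRd R d)) := open_measurable_Rd Dopen.
Let mB : measurable (B : set (BorelRd R d)) := cball_measurable o r.
Let Hsh h : H h -> subharmonic lam D h.
Proof. by case: H_cone => + _ _ _ _; exact. Qed.
Let lamB : (lam B < +oo)%E := lam_cball_lty lam_leb o r.

Let gD : {within D, continuous g}.
Proof. by apply: continuous_in_subspaceT => x /[!inE]; exact: g_cont. Qed.

Let H_measurable h : H h -> measurable_fun (D : set (BorelRd R d)) h.
Proof. by move=> /Hsh sh; apply: subharmonic_measurable sh _ _. Qed.

Let H_measurableB h : H h -> measurable_fun (B : set (BorelRd R d)) h.
Proof. by move=> /Hsh sh; apply: subharmonic_measurable sh _ _. Qed.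

Let intB_integrable h : H h -> intB h != -oo%E ->
  lam.-integrable (B : set (BorelRd R d)) h.
Proof.
move=> Hh; have [M _ hM] := subharmonic_bounded (Hsh Hh) (@cball_compact _ _ o r) BD.
exact: (integrable_bounded_above mB lamB (H_measurableB Hh) hM).
Qed.

Let H_integrableB h : H h -> not_minfty D h -> lam.-integrable (B : set (BorelRd R d)) h.
Proof.
move=> /Hsh sh hn; apply: (subharmonic_integrable d0 lam_leb D_dom sh hn) => //.
exact: cball_compact.
Qed.

Let mu_lty (mu : {measure set (BorelRd R d) -> \bar R}) (A : set (BorelRd R d)) :
  measurable A -> (mu setT < +oo)%E -> (mu A < +oo)%E.
Proof. by move=> mA; apply: le_lt_trans; apply: le_measure; rewrite ?inE. Qed.

(** The inequality defining [J_H] bounds the integral against [mu] from below by [\int_B h], finite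
    by local integrability; on the compact set carrying [mu], [h] is bounded above. *)
Let J_integrable mu h : J mu -> H h -> not_minfty D h ->
  mu.-integrable (D : set (BorelRd R d)) h.
Proof.
move=> [[muT [K [cK KD muK]]] muH] Hh hn; have mh := H_measurable Hh.
have mK := compact_measurable_Rd cK.
have [M _ hM] := subharmonic_bounded (Hsh Hh) cK KD.
have mhK : measurable_fun (K : set (BorelRd R d)) h by exact: measurable_funS mh.
have /integrableP[_ hK] : mu.-integrable (K : set (BorelRd R d)) h.
  apply: (integrable_bounded_above mK (mu_lty mK muT) mhK hM).
  rewrite -(integral_null_setC mD mK KD muK mh) -ltNye.
  apply: lt_le_trans (muH _ Hh).
  have := integrable_fin_num mB (H_integrableB Hh hn).
  by rewrite fin_numE => /andP[]; rewrite ltNye.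
apply/integrableP; split => //.
rewrite (integral_null_setC mD mK KD muK)//; exact: measurableT_comp.
Qed.

Let continuous_integrable (mu : {measure set (BorelRd R d) -> \bar R}) K (f : 'rV[R]_d -> R) :
  (mu setT < +oo)%E -> compact K -> {within K, continuous f} ->
  mu.-integrable (K : set (BorelRd R d)) (fun x => (f x)%:E).
Proof.
move=> muT cK cf; have mK := compact_measurable_Rd cK.
have [M M0 fM] := within_continuous_bounded cK cf.
apply: (measurable_bounded_integrable (f := f : BorelRd R d -> R)) => //.
- exact: mu_lty.
- apply/measurable_EFinP; apply: usc_within_measurable => //.
  exact: within_continuous_usc.
- exists M; split; first exact: num_real.
  by move=> y /ltW My x /fM/le_trans; apply.
Qed.

Let J_integrable_g mu : J mu ->
  mu.-integrable (D : set (BorelRd R d)) (fun x => (g x)%:E).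
Proof.
move=> [[muT [K [cK KD muK]]] _]; have mK := compact_measurable_Rd cK.
have /integrableP[_ gK] : mu.-integrable (K : set (BorelRd R d)) (fun x => (g x)%:E).
  by apply: continuous_integrable => //; exact: continuous_subspaceW gD.
have mg : measurable_fun (D : set (BorelRd R d)) (fun x => (g x)%:E).
  by apply: usc_within_measurable => //; exact: within_continuous_usc.
apply/integrableP; split => //.
rewrite (integral_null_setC mD mK KD muK)//; exact: measurableT_comp.
Qed.

Lemma duality_le (f : 'rV[R]_d -> \bar R) h mu :
  {ae lam, forall x : BorelRd R d, D x -> f x = ((g x)%:E + h1 x - h2 x)%E} ->
  H h -> not_minfty D h ->
  {ae lam, forall x : BorelRd R d, D x -> (h x <= f x)%E} ->
  J mu -> (intB h <= int_s D g h1 h2 mu)%E.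
Proof.
move=> f_ae Hh hn hf Jmu.
have [_ HD _ _ _] := H_cone; have [h' [Hh' h'E]] := HD _ _ Hh h2H.
have h'le x : D x -> (h' x <= (g x)%:E + h1 x)%E.
  apply: (subharmonic_le_usc (w := fun x => ((g x)%:E + h1 x)%E) d0 lam_leb D_dom (Hsh Hh')).
    apply: usc_within_addr => //.
    exact: (@subharmonic_usc_within _ _ lam D h1 D (Hsh h1H) (@subset_refl _ D)).
  apply: filterS2 f_ae hf => {}x fx hx Dx; rewrite h'E//.
  have := hx Dx; rewrite fx//; have [h2lt _ _] := Hsh h2H.
  (* Where [h2 = -oo] the left side is [-oo] and the claim is trivial. *)
  by case: (h2 x) (h2lt x Dx) => [s| |]// _; rewrite ?addeNy ?leNye// leeBrDr.
have [_ muH] := Jmu; apply: (le_trans (muH _ Hh)).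
have ih := J_integrable Jmu Hh hn; have ih1 := J_integrable Jmu h1H h1_ninf.
have ih2 := J_integrable Jmu h2H h2_ninf; have ig := J_integrable_g Jmu.
rewrite /int_s leeBrDr; last exact: integrable_fin_num.
rewrite -!integralD//; apply: le_integral => //; try exact: integrableD.
by move=> x /[!inE] Dx; rewrite -h'E//; exact: h'le.
Qed.

(** * The supporting functional on one compact set *)

Section Step.
Variables (K : set 'rV[R]_d) (cK : compact K) (KD : K `<=` D) (BK : B `<=` K).

(** The first component is an arbitrary function, so that the vector structure is inherited;
    continuity on [K] is carried by the subspace [S]. *)
Let V : lmodType R := (('rV[R]_d -> R) * R)%type.
Let S : set V := [set z | {within K, continuous (z.1 : 'rV[R]_d -> R)}].

(* [h2] may take the value [-oo], so "[h <= phi - tau h2] on [K]" is required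
   only where [h2] is finite, which is almost everywhere. *)
Let minorants (z : V) : set R := [set c | exists h, [/\ H h,
  (forall x, K x -> h2 x != -oo%E -> (h x + (z.2 : R)%:E * h2 x <= (z.1 x : R)%:E)%E) &
  (c%:E <= intB h)%E]].

Let gain (z : V) : R := sup (minorants z).

Let h2_real x : K x -> h2 x != -oo%E -> exists s : R, h2 x = s%:E.
Proof.
move=> /KD Dx; have [h2lt _ _] := Hsh h2H.
by case: (h2 x) (h2lt x Dx) => [s| |]// _ _; exists s.
Qed.

Let H_cst (c : R) : 0 <= c -> exists h, H h /\ forall x, D x -> h x = (- c)%:E.
Proof.
have [_ _ HZ [_ [hm [Hm hmE]]] _] := H_cone => c0.
have [h [Hh hE]] := HZ c _ c0 Hm; exists h; split => // x Dx.
by rewrite hE// hmE// -EFinM mulrN1.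
Qed.

Let H_zero : exists h, H h /\ forall x, D x -> h x = 0%E.
Proof. by have [_ _ _ []] := H_cone. Qed.

Let minorants_add z w c e : minorants z c -> minorants w e -> minorants (z + w) (c + e).
Proof.
move=> [h [Hh hz hc]] [k [Hk kw ke]]; have [_ HD _ _ _] := H_cone.
have [f [Hf fE]] := HD _ _ Hh Hk; exists f; split => //.
- move=> x Kx x2; rewrite fE; last exact: KD.
  have := hz x Kx x2; have := kw x Kx x2; have [s ->] := h2_real Kx x2.
  have [hlt _ _] := Hsh Hh; have [klt _ _] := Hsh Hk.
  have Dx := KD Kx.
  case: (h x) (hlt x Dx) => [a| |]// _; case: (k x) (klt x Dx) => [b| |]// _;
    rewrite ?(addeNy, addNye, leNye)//.
  rewrite -!EFinM -!EFinD !lee_fin /= => wk zh.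
  by rewrite mulrDl addrACA; exact: (lerD zh wk).
- have ih : lam.-integrable (B : set (BorelRd R d)) h.
    by apply: intB_integrable => //; rewrite -ltNye (lt_le_trans (ltNyr c)).
  have ik : lam.-integrable (B : set (BorelRd R d)) k.
    by apply: intB_integrable => //; rewrite -ltNye (lt_le_trans (ltNyr e)).
  rewrite (@eq_integral _ _ _ _ _ (fun x : BorelRd R d => (h x + k x)%E)); last first.
    by move=> x /[!inE] Bx; rewrite fE//; exact: BD.
  by rewrite integralD// EFinD leeD.
Qed.

Let minorants_scale (t : R) z c : 0 < t -> minorants z c -> minorants (t *: z) (t * c).
Proof.
move=> t0 [h [Hh hz hc]]; have [_ _ HZ _ _] := H_cone.
have [f [Hf fE]] := HZ _ _ (ltW t0) Hh; exists f; split => //.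
- move=> x Kx x2; rewrite fE; last exact: KD.
  have := hz x Kx x2; have [s ->] := h2_real Kx x2.
  have [hlt _ _] := Hsh Hh; have Dx := KD Kx.
  case: (h x) (hlt x Dx) => [a| |]// _; last by rewrite gt0_muleNy ?lte_fin ?addNye ?leNye.
  rewrite -!EFinM -!EFinD !lee_fin /= => zh.
  by rewrite -mulrA -mulrDr; exact: (ler_wpM2l (ltW t0) zh).
- have ih : lam.-integrable (B : set (BorelRd R d)) h.
    by apply: intB_integrable => //; rewrite -ltNye (lt_le_trans (ltNyr c)).
  rewrite (@eq_integral _ _ _ _ _ (fun x : BorelRd R d => (t%:E * h x)%E)); last first.
    by move=> x /[!inE] Bx; rewrite fE//; exact: BD.
  by rewrite integralZl// EFinM lee_pmul2l.
Qed.

(** Finiteness of [gain]: the negative constants of [H] provide a minorant, and integrating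
    [h + tau h2 <= M] over [B], where [h2] is integrable, gives the upper bound. *)
Let minorants_has_sup z : S z -> has_sup (minorants z).
Proof.
case: z => [phi tau]; have [T ->] : exists T : R, tau = T by exists tau.
move=> Sz; have [M M0 zM] := within_continuous_bounded cK Sz; rewrite /= in zM.
rewrite /minorants /=.
have ih2 := H_integrableB h2H h2_ninf; split.
  have [_ HD HZ _ _] := H_cone.
  have [M2 M20 h2M] := subharmonic_bounded (Hsh h2H) cK KD.
  (* For [f = - (M + |T| M2) + max (- T) 0 * h2], the sum [f + T h2] equals
     [- (M + |T| M2) + max T 0 * h2] wherever [h2] is finite, hence is at most [- M] on [K]. *)
  have [k0 [Hk0 k0E]] := H_cst (addr_ge0 M0 (mulr_ge0 (normr_ge0 T) M20)).
  have [k1 [Hk1 k1E]] := HZ (Num.max (- T) 0) _ (ltac:(by rewrite le_max lexx orbT)) h2H.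
  have [f [Hf fE]] := HD _ _ Hk0 Hk1.
  have fE' x : D x -> (f x = (- (M + `|T| * M2))%:E + (Num.max (- T) 0)%:E * h2 x)%E.
    by move=> Dx; rewrite fE// k0E// k1E.
  have fn : not_minfty D f.
    have [x [Dx h2x]] := h2_ninf; exists x; split => //; rewrite fE'//.
    have [h2lt _ _] := Hsh h2H; move: (h2lt x Dx) h2x.
    by case: (h2 x).
  exists (fine (intB f)), f; split => //; last first.
    by rewrite fineK//; apply: integrable_fin_num => //; exact: H_integrableB.
  move=> x Kx x2; rewrite fE'; last exact: KD.
  have := h2M x Kx; have [s ->] := h2_real Kx x2.
  rewrite -!EFinM -!EFinD !lee_fin => sM.
  have := zM x Kx; rewrite ler_norml => /andP[zl _]; apply: le_trans zl.
  have [t0|t0] := leP 0 T.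
    rewrite max_r ?oppr_le0// mul0r addr0 ger0_norm//.
    by have := ler_wpM2l t0 sM; lra.
  rewrite max_l ?oppr_ge0 ?(ltW t0)//.
  by have := mulr_ge0 (normr_ge0 T) M20; lra.
exists (M * fine (lam B) - T * fine (intB h2)) => c [h [Hh hz hc]].
have ih : lam.-integrable (B : set (BorelRd R d)) h.
  by apply: intB_integrable => //; rewrite -ltNye (lt_le_trans (ltNyr c)).
have izh2 : lam.-integrable (B : set (BorelRd R d)) (fun x => (T%:E * h2 x)%E).
  exact: integrableZl.
have : (\int[lam]_(x in (B : set (BorelRd R d))) (h x + T%:E * h2 x) <= M%:E * lam B)%E.
  apply: integral_le_cst_ae => //.
    by apply: emeasurable_funD; [case/integrableP: ih|case/integrableP: izh2].
  apply: filterS (integrable_ae mB ih2) => x h2x Bx.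
  have h2x' : h2 x != -oo%E by have := h2x Bx; rewrite fin_numE => /andP[].
  apply: le_trans (hz x (BK Bx) h2x') _; rewrite lee_fin.
  by have := zM x (BK Bx); rewrite ler_norml => /andP[].
rewrite integralD// integralZl//.
move: hc (integrable_fin_num mB ih) (integrable_fin_num mB ih2) (lam_cball_fin lam_leb o r).
case: (intB h) => [a| |]//; case: (intB h2) => [b| |]//; case: (lam B) => [l| |]//= + _ _ _.
by rewrite -!EFinM -!EFinD !lee_fin => ? ?; lra.
Qed.

Let gain_ge z c : S z -> minorants z c -> c <= gain z.
Proof. by move=> Sz zc; apply: ub_le_sup => //; case: (minorants_has_sup Sz). Qed.

Let gain_add z w : S z -> S w -> S (z + w) -> gain z + gain w <= gain (z + w).
Proof.
move=> Sz Sw Szw; rewrite -lerBrDr; apply: ge_sup; first by case: (minorants_has_sup Sz).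
move=> c zc; rewrite lerBrDr addrC -lerBrDr.
apply: ge_sup; first by case: (minorants_has_sup Sw).
by move=> e we; rewrite lerBrDr addrC; apply: gain_ge => //; exact: minorants_add.
Qed.

Let gain_scale (t : R) z : 0 < t -> S z -> S (t *: z) -> t * gain z <= gain (t *: z).
Proof.
move=> t0 Sz Stz; rewrite -ler_pdivlMl//; apply: ge_sup; first by case: (minorants_has_sup Sz).
move=> c zc; rewrite ler_pdivlMl//; apply: gain_ge => //; exact: minorants_scale.
Qed.

Let S_lin (t : R) z w : S z -> S w -> S (z + t *: w).
Proof. by move=> Sz Sw; exact: (within_continuous_lin t Sz Sw). Qed.

Lemma duality_step (phi : 'rV[R]_d -> R) (m : R) : {within K, continuous phi} ->
  (forall x, K x -> (h1 x <= (phi x)%:E)%E) ->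
  (forall mu, J mu -> (m%:E < int_s D g h1 h2 mu)%E) ->
  exists h, [/\ H h,
    (forall x, K x -> h2 x != -oo%E -> (h x + h2 x <= (g x + phi x)%:E)%E) &
    (m%:E <= intB h)%E].
Proof.
move=> cphi h1phi mJ.
have cg : {within K, continuous g} by exact: continuous_subspaceW gD.
pose G x := g x + phi x.
have cG : {within K, continuous G} by exact: within_continuousD.
have S0 (f : 'rV[R]_d -> R) (tau : R) : {within K, continuous f} -> S (f, tau) by [].
have cz : {within K, continuous (fun=> 0 : R)} by exact: within_continuous_cst.
have SZ (t : R) z : S z -> S (t *: z).
  by move=> Sz; have := @S_lin t _ _ (S0 _ 0 cz) Sz; rewrite add0r.
have SD z w : S z -> S w -> S (z + w).
  by move=> Sz Sw; have := @S_lin 1 _ _ Sz Sw; rewrite scale1r.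
(* Superlinearity of [gain] makes [- gain] sublinear; thus [- L] dominates [gain], with equality at
   [(G, 1)]. *)
have [|t z t0 Sz|L [Llin Lp Lv]] := @hahn_banach R V S (fun z => - gain z) (@S_lin) _ _ (G, 1) (S0 G 1 cG).
- by move=> z w Sz Sw; rewrite -opprD lerN2; apply: gain_add => //; exact: SD.
- by rewrite mulrN lerN2; apply: gain_scale => //; exact: SZ.
pose ell (f : 'rV[R]_d -> R) := - L (f, 0).
pose a := - L (fun=> 0, 1).
have Lsplit (f : 'rV[R]_d -> R) (tau : R) : {within K, continuous f} ->
    - L (f, tau) = ell f + tau * a.
  move=> cf; have := Llin tau _ _ (S0 f 0 cf) (S0 _ 1 cz).
  rewrite (_ : (f, 0) + tau *: (fun=> 0, 1) = (f, tau) :> V); last first.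
    congr pair; last by rewrite /= add0r [_ *: _]mulr1.
    by apply/funext => x; rewrite -[LHS]/(f x + tau * 0) mulr0 addr0.
  by move=> ->; rewrite /ell /a; ring.
have gain_ell (f : 'rV[R]_d -> R) (tau : R) : {within K, continuous f} ->
    gain (f, tau) <= ell f + tau * a.
  by move=> cf; rewrite -Lsplit// lerNr; apply: Lp; exact: S0.
have ell_lin (t : R) (f f' : 'rV[R]_d -> R) : {within K, continuous f} ->
    {within K, continuous f'} -> ell (fun x => f x + t * f' x) = ell f + t * ell f'.
  move=> cf cf'; have := Llin t _ _ (S0 f 0 cf) (S0 f' 0 cf').
  rewrite (_ : (f, 0) + t *: (f', 0) = (fun x => f x + t * f' x, 0) :> V); last first.
    by congr pair; rewrite /= add0r [_ *: _]mulr0.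
  by rewrite /ell => ->; ring.
have [k0 [Hk0 k0E]] := H_zero.
have intk0 : intB k0 = 0%E.
  by apply: integral0_eq => x Bx; apply: k0E; exact: BD.
have ell_ge0 (f : 'rV[R]_d -> R) : {within K, continuous f} ->
    (forall x, K x -> 0 <= f x) -> 0 <= ell f.
  move=> cf f0; have := gain_ell f 0 cf; rewrite mul0r addr0; apply: le_trans.
  apply: gain_ge; first exact: S0.
  exists k0; split => //; last by rewrite intk0.
  by move=> x Kx _ /=; rewrite mul0e adde0 k0E ?lee_fin ?f0//; exact: KD.
have [nu [nuT nuK nuE]] := riesz_representation cK ell_lin ell_ge0.
have mK := compact_measurable_Rd cK.
have K0 : K !=set0 by exists o; apply/BK/cball_refl/ltW.
have intD u : H u -> (\int[nu]_(x in (D : set (BorelRd R d))) u x =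
    \int[nu]_(x in (K : set (BorelRd R d))) u x)%E.
  by move=> Hu; apply: integral_null_setC => //; exact: H_measurable.
have nu_ge u (c : R) : H u ->
    (forall f : 'rV[R]_d -> R, {within K, continuous f} ->
      (forall x, K x -> (u x <= (f x)%:E)%E) -> c <= ell f) ->
    (c%:E <= \int[nu]_(x in (D : set (BorelRd R d))) u x)%E.
  move=> Hu uc; rewrite intD//; apply: usc_integral_ge => //.
  - exact: mu_lty.
  - by apply: (subharmonic_usc_within (Hsh Hu)).
  - by move=> x /KD Dx; case: (Hsh Hu) => + _ _; exact.
  - move=> f cf uf; have cfK : {within K, continuous f} by exact: continuous_subspaceT.
    by rewrite nuE// lee_fin; exact: uc.
(* For continuous [f >= u] on [K], [u] itself is a minorant of [(f, 0)], whence [\int_B u <= ell f];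
   letting [f] decrease towards [u] gives the inequality for [nu]. *)
have Jnu : J nu.
  split; first by split => //; exists K.
  move=> u Hu; have [->|un] := eqVneq (intB u) -oo%E; first exact: leNye.
  have uE : intB u = (fine (intB u))%:E.
    by rewrite fineK// integrable_fin_num//; exact: intB_integrable.
  rewrite uE; apply: nu_ge => // f cf uf.
  have := gain_ell f 0 cf; rewrite mul0r addr0; apply: le_trans.
  apply: gain_ge; first exact: S0.
  exists u; split => //; last by rewrite uE.
  by move=> x Kx _ /=; rewrite mul0e adde0; exact: uf.
(* [0] is a minorant of [(f, 1)] as soon as [f >= h2] on [K], so [0 <= ell f + a]. *)
have h2a : ((- a)%:E <= \int[nu]_(x in (D : set (BorelRd R d))) h2 x)%E.
  apply: nu_ge => // f cf h2f; have := gain_ell f 1 cf; rewrite mul1r.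
  have : 0 <= gain (f, 1).
    apply: gain_ge; first exact: S0.
    exists k0; split => //; last by rewrite intk0.
    by move=> x Kx _ /=; rewrite mul1e k0E ?add0e ?h2f//; exact: KD.
  by move=> ? ?; lra.
have gainG : gain (G, 1) = ell g + ell phi + a.
  rewrite -[LHS]opprK -Lv Lsplit// mul1r; congr (_ + _).
  have := ell_lin 1 g phi cg cphi; rewrite mul1r => <-.
  by congr ell; apply/funext => x; rewrite mul1r.
have mg : measurable_fun (D : set (BorelRd R d)) (fun x => (g x)%:E).
  by apply: usc_within_measurable => //; exact: within_continuous_usc.
(* [\int s dnu <= gain (G, 1)] since [\int h1 dnu <= ell phi] and [- a <= \int h2 dnu]. The strict
   inequality yields a minorant beyond [m] even if the supremum is not attained. *)
have : (m%:E < (gain (G, 1))%:E)%E.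
  apply: lt_le_trans (mJ _ Jnu) _; rewrite /int_s gainG.
  rewrite (_ : (ell g + ell phi + a)%:E = ((ell g)%:E + (ell phi)%:E - (- a)%:E)%E); last first.
    by rewrite -!EFinD opprK.
  apply: leeB => //; apply: leeD.
    by rewrite (integral_null_setC mD mK KD nuK mg) nuE.
  rewrite intD// -nuE//; apply: le_integral_measurable => //.
  - by apply: (subharmonic_measurable (Hsh h1H)).
  - by apply: usc_within_measurable => //; exact: within_continuous_usc.
rewrite lte_fin => /(sup_gt (proj1 (minorants_has_sup (S0 G 1 cG))))[c [h [Hh hG ch]] mc].
exists h; split => //.
  by move=> x Kx x2; have := hG x Kx x2; rewrite /= mul1e.
by apply: le_trans ch; rewrite lee_fin ltW.
Qed.

End Step.

(** * Passage to the limit along the exhaustion *)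

Let not_minfty_intB h : H h -> intB h != -oo%E -> not_minfty D h.
Proof.
move=> Hh; apply: contra_neqP => nh.
rewrite (@eq_integral _ _ _ _ _ (cst -oo%E)).
  rewrite integral_cst// -(volE lam_leb) mulNyr gtr0_sg ?mul1e//.
  exact: (vol_gt0 lam_leb d0).
by move=> x /[!inE] Bx; apply/eqP/negPn/negP => hx; apply: nh; exists x; split => //; exact: BD.
Qed.

Let h2_integrable x t : cball x t `<=` D ->
  lam.-integrable (cball x t : set (BorelRd R d)) h2.
Proof.
move=> xD; apply: (subharmonic_integrable d0 lam_leb D_dom (Hsh h2H) h2_ninf) => //.
exact: cball_compact.
Qed.

Let avg2 x t : R :=
  fine (\int[lam]_(z in (cball x t : set (BorelRd R d))) h2 z)%E / vol lam x t.

Let avg2_ge x t : 0 < t -> cball x t `<=` D -> (h2 x <= (avg2 x t)%:E)%E.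
Proof.
move=> t0 xD; have v0 := vol_gt0 lam_leb d0 x t0.
have := subharmonic_mean d0 lam_leb (Hsh h2H) t0 xD.
rewrite -(fineK (integrable_fin_num (cball_measurable x t) (h2_integrable xD))).
by rewrite -lee_pdivlMl// -EFinM mulrC.
Qed.

(* The integral of [h2 - M <= 0] over [cball y t] is at least its integral over
   [cball x (2 t)], and the doubling constant [C] compares the two volumes. *)
Let mean_estimate h (C a M t : R) x y : 0 < C ->
  (forall x y s, 0 < s -> vol lam x (2 * s) <= C * vol lam y s) ->
  H h -> not_minfty D h -> 0 < t -> cball x (2 * t) `<=` D ->
  (forall z, cball x (2 * t) z -> h2 z != -oo%E -> (h z + h2 z <= a%:E)%E) ->
  (forall z, cball x (2 * t) z -> (h2 z <= M%:E)%E) ->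
  cball x t y -> (h y <= (a - M + C * (M - avg2 x (2 * t)))%:E)%E.
Proof.
move=> C0 dbl Hh hn t0 xD ha hM xy.
have t20 : 0 < 2 * t by lra.
have yx : cball y t `<=` cball x (2 * t).
  by apply: subset_cball; rewrite /cball/= in xy; lra.
have yD : cball y t `<=` D by exact: subset_trans xD.
have my := cball_measurable y t; have mx := cball_measurable x (2 * t).
have ih : lam.-integrable (cball y t : set (BorelRd R d)) h.
  apply: (subharmonic_integrable d0 lam_leb D_dom (Hsh Hh) hn) => //.
  exact: cball_compact.
have ih2 := h2_integrable yD; have ih2x := h2_integrable xD.
have vy := vol_gt0 lam_leb d0 y t0; have vx := vol_gt0 lam_leb d0 x t20.
have mean := subharmonic_mean d0 lam_leb (Hsh Hh) t0 yD.
have sum_le : (\int[lam]_(z in (cball y t : set (BorelRd R d))) (h z + h2 z) <=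
    a%:E * lam (cball y t))%E.
  apply: integral_le_cst_ae => //.
    by apply: emeasurable_funD; [case/integrableP: ih|case/integrableP: ih2].
  apply: filterS (integrable_ae my ih2) => z zf yz; apply: ha; first exact: yx.
  by have := zf yz; rewrite fin_numE => /andP[].
have icst z s : lam.-integrable (cball z s : set (BorelRd R d)) (cst M%:E).
  have mz := cball_measurable z s.
  apply/integrableP; split; first exact: measurable_cst.
  rewrite (_ : (\int[lam]_(x in _) _ = `|M%:E| * lam (cball z s))%E); last first.
    by rewrite -integral_cst.
  by rewrite ltey_eq fin_numM// lam_cball_fin.
have defect_le : (\int[lam]_(z in (cball y t : set (BorelRd R d))) (cst M%:E z - h2 z) <=
    \int[lam]_(z in (cball x (2 * t) : set (BorelRd R d))) (cst M%:E z - h2 z))%E.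
  apply: ge0_subset_integral => //.
    apply: emeasurable_funB; first exact: measurable_cst.
    by case/integrableP: ih2x.
  by move=> z xz; rewrite sube_ge0 ?hM//= ?orbT.
have defect_ge0 : (0 <= \int[lam]_(z in (cball y t : set (BorelRd R d))) (cst M%:E z - h2 z))%E.
  by apply: integral_ge0 => z /yx xz; rewrite sube_ge0 ?hM//= ?orbT.
move: sum_le defect_le defect_ge0.
rewrite integralD// !integralB// !integral_cst// -!(volE lam_leb).
have := avg2_ge t20 xD; rewrite /avg2.
move: mean (integrable_fin_num my ih) (integrable_fin_num my ih2) (integrable_fin_num mx ih2x).
case: (\int[lam]_(z in _) h z)%E => [I| |]//.
case: (\int[lam]_(z in cball y t) h2 z)%E => [I2| |]//.
case: (\int[lam]_(z in cball x (2 * t)) h2 z)%E => [I2x| |]//= mean _ _ _ _.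
rewrite -!EFinM -!EFinB -!EFinD !lee_fin => sum_le defect_le defect_ge0.
have [hlt _ _] := Hsh Hh; have Dy : D y by apply/yD/cball_refl/ltW.
case: (h y) (hlt y Dy) mean => [s| |]// _; last by rewrite leNye.
rewrite -EFinM !lee_fin => mean.
have dblxy := dbl x y t t0.
set A := I2x / _; have I2xE : I2x = A * vol lam x (2 * t) by rewrite /A divfK// gt_eqF.
have MA : 0 <= M - A.
  by rewrite -(pmulr_lge0 _ vx) mulrBl -I2xE; lra.
have := ler_wpM2l MA dblxy; rewrite mulrBl -I2xE => le_dbl.
rewrite -(ler_pM2l vy) (le_trans mean)//; move: sum_le defect_le le_dbl.
set v := vol lam y t; set W := vol lam x _ => sum_le defect_le.
rewrite (_ : v * (a - M + C * (M - A)) = (M - A) * (C * v) + (a * v - M * v)); last by ring.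
by lra.
Qed.

(** The mean value estimate holds from some rank on; the finitely many earlier terms are bounded
    near [x] by semicontinuity. *)
Let near_bounded_prefix (hs : nat -> 'rV[R]_d -> \bar R) x N : (forall n, H (hs n)) -> D x ->
  exists M : R, \forall y \near x, forall k, (k < N)%N -> (hs k y <= M%:E)%E.
Proof.
move=> Hhs Dx; elim: N => [|N [M nM]]; first by exists 0; near=> y => k.
have [hlt uh _] := Hsh (Hhs N).
have [a ha] := lt_real_of_lty (hlt x Dx).
exists (Num.max M a); apply: filterS2 nM (uh x Dx a ha) => y yM ya k.
rewrite ltnS leq_eqVlt EFin_max => /predU1P[->|kN].
  by rewrite le_max (ltW ya) orbT.
by rewrite le_max yM.
Unshelve. all: by end_near. Qed.

Lemma duality_ge (f : 'rV[R]_d -> \bar R) (m : R) :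
  {ae lam, forall x : BorelRd R d, D x -> f x = ((g x)%:E + h1 x - h2 x)%E} ->
  (forall mu, J mu -> (m%:E < int_s D g h1 h2 mu)%E) ->
  exists h, [/\ H h, not_minfty D h,
    {ae lam, forall x : BorelRd R d, D x -> (h x <= f x)%E} & (m%:E <= intB h)%E].
Proof.
move=> f_ae mJ.
have [E [cE ED Ex]] := compact_exhaustion Dopen.
pose K n := E n `|` B.
have cK n : compact (K n) by apply: compactU => //; exact: cball_compact.
have KD n : K n `<=` D by move=> x [/ED|/BD].
have BK n : B `<=` K n by move=> x Bx; right.
have K0 n : K n !=set0 by exists o; apply/BK/cball_refl/ltW.
have uh1 n := subharmonic_usc_within (Hsh h1H) (@KD n).
have h1lt x : D x -> (h1 x < +oo)%E by case: (Hsh h1H) => + _ _; exact.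
have h2lt x : D x -> (h2 x < +oo)%E by case: (Hsh h2H) => + _ _; exact.
have /choice[phi phiP] := fun n => usc_approx n (cK n) (K0 n) (uh1 n) (fun x Kx => h1lt x (KD n x Kx)).
have cphi n : {within K n, continuous phi n}.
  by apply: continuous_subspaceT; case: (phiP n).
have h1phi n x : K n x -> (h1 x <= (phi n x)%:E)%E by case: (phiP n) => _ + _; exact.
have /choice[hs hsP] := fun n =>
  duality_step (cK n) (@KD n) (@BK n) (cphi n) (h1phi n) mJ.
have Hhs n : H (hs n) by case: (hsP n).
have hsn n : not_minfty D (hs n).
  apply: not_minfty_intB => //; have [_ _ mh] := hsP n.
  by rewrite -ltNye (lt_le_trans (ltNyr m)).
have [C C0 dbl] := vol_doubling lam_leb d0.
(* Near [x] and for large [n], [phi n <= a - g x - e]: the radius [e1 / 2] leaves around each nearby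
   [y] a ball on which [h1] is controlled, and [e] absorbs the variation of [g]. *)
have upper x (a : R) : D x -> ((g x)%:E + h1 x < a%:E)%E ->
    exists N, \forall y \near x, D y /\ forall n, (N <= n)%N -> h2 y != -oo%E ->
      (hs n y + h2 y <= a%:E)%E.
  move=> Dx ga.
  have [e e0 he] : exists2 e, 0 < e & (h1 x < (a - g x - e)%:E)%E.
    exact: addr_lt_real ga.
  have [_ uh _] := Hsh h1H; have /nbhs_ballP[e1 /= e10 e1h] := uh x Dx _ he.
  have d10 : 0 < e1 / 2 by rewrite divr_gt0.
  have [N1 N1P] := usc_approx_rank (a - g x - e) d10.
  have [N2 N2P] := Ex x Dx.
  exists (maxn N1 N2).
  have gnear : \forall y \near x, `|g x - g y| < e.
    by have /cvgrPdist_lt/(_ e e0) : g @ nbhs x --> g x by exact: g_cont.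
  have xnear : \forall y \near x, ball x (e1 / 2) y by exact: nbhsx_ballx.
  have Dnear : \forall y \near x, D y by exact: open_nbhs_nbhs.
  near=> y; split; first by near: y.
  move=> n; rewrite geq_max => /andP[n1 n2] h2y.
  have Kny : K n y.
    left; suff : forall k, (N2 <= k)%N -> E k y by exact.
    by near: y.
  have [_ hsy _] := hsP n; apply: le_trans (hsy y Kny h2y) _; rewrite lee_fin.
  have gy : `|g x - g y| < e by near: y.
  have xy : ball x (e1 / 2) y by near: y.
  have [? ? ?] := N1P n n1; have [_ _ phia] := phiP n.
  have : phi n y <= a - g x - e.
    apply: (phia y (e1 / 2)) => // z Kz yz; apply/ltW/e1h.
    rewrite -ball_normE/=; move: xy; rewrite -ball_normE/= => xy.
    by have := ler_distD y x z; lra.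
  by move: gy; rewrite ltr_norml => /andP[? ?] ?; lra.
(* The bound is uniform in [n] and [y]. The parameter [M > h2 x] is arbitrary for local boundedness
   and close to [h2 x] for the pointwise inequality. *)
have estimate x (a M : R) : D x -> ((g x)%:E + h1 x < a%:E)%E -> (h2 x < M%:E)%E ->
    exists N t, [/\ 0 < t, cball x (2 * t) `<=` D &
      forall n y, (N <= n)%N -> cball x t y ->
        (hs n y <= (a - M + C * (M - avg2 x (2 * t)))%:E)%E].
  move=> Dx ga h2M; have [N NP] := upper x a Dx ga.
  have [_ uh _] := Hsh h2H.
  have [T T0 TP] := cball_sub_nbhs (filterI NP (uh x Dx M h2M)).
  have T2 : 2 * (T / 2) = T by rewrite mulrC divfK.
  exists N, (T / 2); rewrite T2; split; first by rewrite divr_gt0.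
    by move=> y /TP[[]].
  move=> n y Nn xy; rewrite -[X in avg2 x X]T2.
  apply: mean_estimate C0 dbl _ _ _ _ _ _ xy => //; rewrite ?T2 ?divr_gt0//.
  - by move=> z /TP[[]].
  - by move=> z /TP[[_ zP] _] h2z; exact: zP.
  - by move=> z /TP[_ /ltW].
have bounded : loc_unif_bdd_above D hs.
  move=> x Dx.
  have [a ga] : exists a : R, ((g x)%:E + h1 x < a%:E)%E.
    by apply: lt_real_of_lty; rewrite lte_add_pinfty ?ltry ?h1lt.
  have [M h2M] := lt_real_of_lty (h2lt x Dx).
  have [N [t [t0 _ tP]]] := estimate x a M Dx ga h2M.
  have [Q QP] := near_bounded_prefix N Hhs Dx.
  exists (Num.max Q (a - M + C * (M - avg2 x (2 * t)))).
  apply: filterS2 QP (nbhs_cball x t0) => y yQ xy k; rewrite EFin_max le_max.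
  by have [kN|Nk] := ltnP k N; [rewrite yQ|rewrite tP ?orbT].
have [_ _ _ _ Hlim] := H_cone.
have [h [Hh hE]] := Hlim hs Hhs bounded.
pose u y := limn_esup (fun k => hs k y).
have uleh x : D x -> (u x <= h x)%E.
  move=> Dx; rewrite hE//; apply: le_ereal_inf_tmp => _ [e /= e0 <-].
  apply: ereal_sup_ubound; exists x => //; split => //.
  by rewrite /oball/= subrr enorm0.
have hle x : D x -> (h x + h2 x <= (g x)%:E + h1 x)%E.
  move=> Dx; apply: le_of_lt_real => a ga.
  case h2x : (h2 x) (h2lt x Dx) => [b| |]// _; last by rewrite addeNy leNye.
  apply/lee_addgt0Pr => e e0; rewrite -EFinD -leeBrDr// -EFinB.
  have eC : 0 < e / C by rewrite divr_gt0.
  (* With [M = h2 x + e / C], and a mean of [h2] that is at least [h2 x], the term carrying [C] is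
     at most [e] whatever the radius [t]. *)
  have [|N [t [t0 xD tP]]] := estimate x a (b + e / C) Dx ga.
    by rewrite h2x lte_fin ltrDl.
  rewrite hE//; apply: ge_ereal_inf.
  exists (ereal_sup (u @` (D `&` oball x t))); first by exists t.
  apply: ge_ereal_sup => _ [y [Dy /ltW xy] <-].
  apply: (limn_esup_bounded (N := N)) => n Nn; apply: le_trans (tP n y Nn xy) _.
  rewrite lee_fin; have := avg2_ge (_ : 0 < 2 * t) xD; rewrite h2x lee_fin => bA.
  have {}bA : b <= avg2 x (2 * t) by apply: bA; lra.
  have : C * (b + e / C - avg2 x (2 * t)) <= C * (e / C).
    by rewrite ler_wpM2l ?(ltW C0)//; lra.
  have -> : C * (e / C) = e by rewrite mulrC divfK// gt_eqF.
  by move: (e / C) eC => s; lra.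
(* Compactness of [B] turns the local bounds into one bound for all [k]; the reverse Fatou lemma
   applies to [u], and [u <= h]. *)
have mh : (m%:E <= intB h)%E.
  have [x Bx|n nB] := @compact_nat_cover _ _ B (fun n y => forall k, (hs k y <= n%:R%:E)%E)
      (@cball_compact _ _ o r).
    have [M MP] := bounded x (BD Bx); exists (Num.truncn M).+1.
    apply: filterS MP => y yM _ n Nn k; apply: le_trans (yM k) _.
    by rewrite lee_fin (le_trans (ltW (truncnS_gt M)))// ler_nat.
  have mhs k := H_measurableB (Hhs k).
  have := @reverse_fatou _ (BorelRd R d) R lam B mB lamB hs n%:R m mhs.
  move=> /(_ (fun k x Bx => nB x Bx k)) /(_ (fun k => let: And3 _ _ mk := hsP k in mk)).
  move=> /le_trans; apply; apply: le_integral_measurable => //.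
  - exact: measurable_fun_limn_esup.
  - exact: H_measurableB.
  - by move=> x /BD; exact: uleh.
exists h; split => //.
  by apply: not_minfty_intB => //; rewrite -ltNye (lt_le_trans (ltNyr m)).
(* Subtracting [h2] from both sides needs it finite; this holds almost everywhere on each of the
   countably many [K n], which cover [D]. *)
have h2fin : {ae lam, forall x : BorelRd R d, forall n, K n x -> h2 x \is a fin_num}.
  apply: ae_foralln => n; apply: integrable_ae; first exact: compact_measurable_Rd.
  exact: (subharmonic_integrable d0 lam_leb D_dom (Hsh h2H) h2_ninf).
apply: filterS2 f_ae h2fin => x fx x2 Dx; rewrite fx//.
have [N /nbhs_singleton/(_ N (leqnn N)) Nx] := Ex x Dx.
by rewrite leeBrDr; [exact: hle|apply: (x2 N); left].
Unshelve. all: by end_near. Qed.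

End Duality.

Theorem theorem1 (R : realType) (d : nat) (d_gt0 : (0 < d)%N)
  (lam : {measure set (BorelRd R d) -> \bar R})
  (lam_leb : is_lebesgue_measure lam)
  (D : set 'rV[R]_d) (D_dom : is_domain D)
  (o : 'rV[R]_d) (r : R) (oD : D o) (r_gt0 : 0 < r) (BD : cball o r `<=` D)
  (H : set ('rV[R]_d -> \bar R)) (H_cone : good_cone lam D H)
  (g : 'rV[R]_d -> R) (g_cont : forall x, D x -> {for x, continuous g})
  (h1 h2 : 'rV[R]_d -> \bar R) (h1H : H h1) (h2H : H h2)
  (h1_ninf : not_minfty D h1) (h2_ninf : not_minfty D h2)
  (f : 'rV[R]_d -> \bar R)
  (f_ae : {ae lam, forall x : BorelRd R d, D x -> f x = ((g x)%:E + h1 x - h2 x)%E}) :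
  let LHS := ereal_sup
    [set (\int[lam]_(x in (cball o r : set (BorelRd R d))) h x)%E
     | h in [set h | [/\ H h, not_minfty D h &
                      {ae lam, forall x : BorelRd R d, D x -> (h x <= f x)%E}]]] in
  let RHS := ereal_inf [set int_s D g h1 h2 mu | mu in JH lam D H o r] in
  LHS = RHS /\
  ((exists h, [/\ H h, not_minfty D h &
               {ae lam, forall x : BorelRd R d, D x -> (h x <= f x)%E}])
   <-> RHS != -oo%E).
Proof.
move=> LHS RHS.
(* Applied to every real [m] below the infimum it gives the lower bound, and to a single one the
   existence of [h]. *)
have attained (m : R) : (m%:E < RHS)%E -> exists h, [/\ H h, not_minfty D h,
    {ae lam, forall x : BorelRd R d, D x -> (h x <= f x)%E} &
    (m%:E <= \int[lam]_(x in (cball o r : set (BorelRd R d))) h x)%E].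
  move=> mR; apply: (duality_ge d_gt0 lam_leb D_dom r_gt0 BD H_cone g_cont h1H h2H h2_ninf f_ae).
  by move=> mu Jmu; apply: lt_le_trans mR _; apply: ereal_inf_lbound; exists mu.
have LR : LHS = RHS.
  apply/eqP; rewrite eq_le; apply/andP; split.
    apply: ge_ereal_sup => _ [h [Hh hn hf] <-]; apply: le_ereal_inf_tmp => _ [mu Jmu <-].
    exact: (duality_le d_gt0 lam_leb D_dom BD H_cone g_cont h1H h2H h1_ninf h2_ninf f_ae).
  (* After a change of sign, comparison with all reals also settles infinite values, such as the
     infimum over an empty [J_H]. *)
  rewrite -leeN2; apply: le_of_lt_real => a; rewrite lteNl -EFinN => /attained[h [Hh hn hf mh]].
  rewrite leeNl -EFinN; apply: le_trans mh _.
  by apply: ereal_sup_ubound; exists h.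
split => //; split => [[h [Hh hn hf]]|].
  rewrite -LR -ltNye; apply: (@lt_le_trans _ _
    (\int[lam]_(x in (cball o r : set (BorelRd R d))) h x)%E).
    have Hsh : subharmonic lam D h by case: H_cone => + _ _ _ _; exact.
    have := subharmonic_integrable d_gt0 lam_leb D_dom Hsh hn (@cball_compact _ _ o r) BD.
    move=> /(integrable_fin_num (cball_measurable o r)).
    by rewrite fin_numE ltNye => /andP[].
  by apply: ereal_sup_ubound; exists h.
move=> Rn; have [m mR] : exists m : R, (m%:E < RHS)%E.
  case: RHS Rn {attained LR} => [s| |]// _; last by exists 0; exact: ltry.
  by exists (s - 1); rewrite lte_fin ltrBlDr ltrDl.
by have [h [Hh hn hf _]] := attained m mR; exists h.
Qed.
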